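(* Every irreducible representation of $U_q({\rm iso}_2)$ is equivalent to one of the representations $R_{rs}$ (with $r,s\in\mathbf C\setminus\{0\}$, $s\neq\pm\mathrm{i}q^n$ for all $n\in\mathbf Z$) or $R_r^{\varepsilon,\tilde\varepsilon}$ (with $r\in\mathbf C\setminus\{0\}$, $\varepsilon,\tilde\varepsilon\in\{1,-1\}$), or is one-dimensional.
   Context: $q$ is a nonzero complex number which is not a root of unity, with a fixed square root $q^{1/2}$; $\mathrm{i}=\sqrt{-1}$. $U_q({\rm iso}_2)$ is the complex associative algebra with unit generated by $I,T_1,T_2$ subject to $$q^{1/2}IT_2-q^{-1/2}T_2I=T_1,\qquad q^{1/2}T_1I-q^{-1/2}IT_1=T_2,\qquad q^{1/2}T_2T_1-q^{-1/2}T_1T_2=0.$$ A representation $\pi$ of $U_q({\rm iso}_2)$ is a homomorphism into the algebra of linear operators (bounded or unbounded) on a Hilbert space $\mathcal H$, defined on an everywhere dense invariant subspace $\mathcal D$, such that $\pi(I)$ can be diagonalized, has a discrete (point) spectrum (with finite multiplicities of spectral points if $\pi$ is irreducible), and its eigenvectors belong to $\mathcal D$; this is understood as: $\mathcal D$ is the linear span of eigenvectors of $\pi(I)$. It is irreducible if $\mathcal D\neq 0$ and the only invariant linear subspaces of $\mathcal D$ are $0$ and $\mathcal D$. Two representations $\pi,\pi'$ on $\mathcal H,\mathcal H'$ are (algebraically) equivalent if there exist everywhere dense invariant subspaces $V\subset\mathcal H$, $V'\subset\mathcal H'$ and a one-to-one linear operator $A:V\to V'$ (a bijection) such that $A\pi(a)v=\pi'(a)Av$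 for all $a\in U_q({\rm iso}_2)$ and $v\in V$. For $r,s\in\mathbf C\setminus\{0\}$ with $s\neq\pm\mathrm{i}q^n$ for all $n\in\mathbf Z$, $R_{rs}$ is the representation on the dense domain $\mathcal D={\rm lin}\{|m\rangle:m\in\mathbf Z\}$ of the Hilbert space with orthonormal basis $|m\rangle$, $m\in\mathbf Z$, given by $$R_{rs}(I)|m\rangle=\mathrm{i}\,\frac{sq^m-s^{-1}q^{-m}}{q-q^{-1}}\,|m\rangle,\qquad R_{rs}(T_2)|m\rangle=\frac{r}{sq^m+s^{-1}q^{-m}}\big\{|m+1\rangle+|m-1\rangle\big\},$$ $$R_{rs}(T_1)|m\rangle=\frac{\mathrm{i}q^{1/2}r}{sq^m+s^{-1}q^{-m}}\big\{sq^m|m+1\rangle-s^{-1}q^{-m}|m-1\rangle\big\}.$$ For $r\in\mathbf C\setminus\{0\}$ and $\varepsilon,\tilde\varepsilon\in\{1,-1\}$, $R=R_r^{\varepsilon,\tilde\varepsilon}$ is the representation with domain the space with linear basis $|j\rangle$, $j=0,1,2,\ldots$ (a dense subspace of its Hilbert space completion), given by $$R(I)|j\rangle=-\varepsilon\frac{q^{j+1/2}+q^{-j-1/2}}{q-q^{-1}}|j\rangle,\quad j\ge 0,$$ $$R(T_2)|0\rangle=-\varepsilon\frac{r}{q^{1/2}-q^{-1/2}}\big(\tilde\varepsilon|0\rangle+\mathrm{i}|1\rangle\big),\qquad R(T_2)|j\rangle=-\varepsilon\frac{\mathrm{i}r}{q^{j+1/2}-q^{-j-1/2}}\big(|j+1\rangle+|j-1\rangle\big),\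 j\ge1,$$ $$R(T_1)|0\rangle=\frac{r}{q^{1/2}-q^{-1/2}}\big(\tilde\varepsilon|0\rangle+\mathrm{i}q|1\rangle\big),\qquad R(T_1)|j\rangle=\frac{\mathrm{i}r}{q^{j+1/2}-q^{-j-1/2}}\big(q^{j+1}|j+1\rangle+q^{-j}|j-1\rangle\big),\ j\ge1.$$ *)

(* Defs.v *)
(* The field of complex numbers is R[i], for R : realType. *)
From HB Require Import structures.
From mathcomp Require Import all_boot all_order all_algebra.
From mathcomp Require Import complex.
From mathcomp Require Import all_classical all_reals all_analysis.

Set Implicit Arguments.
Unset Strict Implicit.
Unset Printing Implicit Defensive.

Import Order.TTheory GRing.Theory Num.Theory Num.Def.
Import numFieldNormedType.Exports.
Local Open Scope classical_set_scope.
Local Open Scope quotient_scope.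
Local Open Scope complex_scope.
Local Open Scope ring_scope.

(* The algebra U_q(iso_2): formal expressions in the generators, modulo the
   congruence generated by the axioms of unital associative algebras and the
   three defining relations. The parameter p is the fixed square root of q. *)
Inductive uq_gen : Set := gI | gT1 | gT2.

Section Algebra.
Variables (K : fieldType) (p : K).

Inductive uq_term : Type :=
| Gen of uq_gen
| Scal of K
| Add of uq_term & uq_term
| Mul of uq_term & uq_term.

Local Notation T := uq_term.
Local Notation "a ⊕ b" := (Add a b) (at level 50, left associativity).
Local Notation "a ⊗ b" := (Mul a b) (at level 40, left associativity).

Inductive uq_rel : T -> T -> Prop :=
| rel_refl a : uq_rel a a
| rel_sym a b : uq_rel a b -> uq_rel b a
| rel_trans b a c : uq_rel a b -> uq_rel b c -> uq_rel a c
| rel_add a a' b b' : uq_rel a a' -> uq_rel b b' -> uq_rel (a ⊕ b) (a' ⊕ b')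
| rel_mul a a' b b' : uq_rel a a' -> uq_rel b b' -> uq_rel (a ⊗ b) (a' ⊗ b')
| rel_addA a b c : uq_rel (a ⊕ (b ⊕ c)) (a ⊕ b ⊕ c)
| rel_addC a b : uq_rel (a ⊕ b) (b ⊕ a)
| rel_add0 a : uq_rel (Scal 0 ⊕ a) a
| rel_addN a : uq_rel (Scal (-1) ⊗ a ⊕ a) (Scal 0)
| rel_mulA a b c : uq_rel (a ⊗ (b ⊗ c)) (a ⊗ b ⊗ c)
| rel_1mul a : uq_rel (Scal 1 ⊗ a) a
| rel_mulDl a b c : uq_rel ((a ⊕ b) ⊗ c) (a ⊗ c ⊕ b ⊗ c)
| rel_mulDr a b c : uq_rel (a ⊗ (b ⊕ c)) (a ⊗ b ⊕ a ⊗ c)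
| rel_scalD k l : uq_rel (Scal (k + l)) (Scal k ⊕ Scal l)
| rel_scalM k l : uq_rel (Scal (k * l)) (Scal k ⊗ Scal l)
| rel_scalC k a : uq_rel (Scal k ⊗ a) (a ⊗ Scal k)
| rel_T1 : uq_rel (Scal p ⊗ (Gen gI ⊗ Gen gT2)
                     ⊕ Scal (- p^-1) ⊗ (Gen gT2 ⊗ Gen gI)) (Gen gT1)
| rel_T2 : uq_rel (Scal p ⊗ (Gen gT1 ⊗ Gen gI)
                     ⊕ Scal (- p^-1) ⊗ (Gen gI ⊗ Gen gT1)) (Gen gT2)
| rel_T12 : uq_rel (Scal p ⊗ (Gen gT2 ⊗ Gen gT1)
                     ⊕ Scal (- p^-1) ⊗ (Gen gT1 ⊗ Gen gT2)) (Scal 0).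

HB.instance Definition _ := gen_eqMixin uq_term.
HB.instance Definition _ := gen_choiceMixin uq_term.

Definition uq_relb (a b : T) : bool := `[< uq_rel a b >].

Lemma uq_relb_equiv : equiv_class_of uq_relb.
Proof.
split=> [a|a b|b a c]; first by apply/asboolP; exact: rel_refl.
  by apply/asboolP/asboolP; exact: rel_sym.
by move=> /asboolP ab /asboolP bc; apply/asboolP; exact: rel_trans ab bc.
Qed.

Canonical uq_relb_equivRel := EquivRelPack uq_relb_equiv.
Canonical uq_relb_encModRel := defaultEncModRel uq_relb.

Definition Uiso2 := {eq_quot uq_relb}.
HB.instance Definition _ : EqQuotient T uq_relb Uiso2 := EqQuotient.on Uiso2.
HB.instance Definition _ := Choice.on Uiso2.

Local Notation cls := (\pi_Uiso2).

Lemma uq_clsP a b : uq_rel a b <-> cls a = cls b.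
Proof.
split=> [ab|/eqP]; first by apply/eqP; rewrite piE; apply/asboolP.
by rewrite piE => /asboolP.
Qed.

Lemma uq_repr a : uq_rel (repr (cls a)) a.
Proof. by apply/uq_clsP; rewrite reprK. Qed.

Definition uq_zero : Uiso2 := cls (Scal 0).
Definition uq_one : Uiso2 := cls (Scal 1).
Definition uq_add := lift_op2 Uiso2 Add.
Definition uq_mul := lift_op2 Uiso2 Mul.
Definition uq_scale (k : K) (x : Uiso2) : Uiso2 := uq_mul (cls (Scal k)) x.
Definition uq_opp (x : Uiso2) : Uiso2 := uq_scale (-1) x.

Lemma uq_addE a b : uq_add (cls a) (cls b) = cls (a ⊕ b).
Proof. by unlock uq_add; apply/uq_clsP; apply: rel_add; exact: uq_repr. Qed.

Lemma uq_mulE a b : uq_mul (cls a) (cls b) = cls (a ⊗ b).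
Proof. by unlock uq_mul; apply/uq_clsP; apply: rel_mul; exact: uq_repr. Qed.

Local Ltac uq_lift :=
  rewrite ?/uq_opp ?/uq_scale /uq_zero /uq_one !(uq_addE, uq_mulE);
  apply/uq_clsP.

Lemma uq_addA : associative uq_add.
Proof. by elim/quotW=> a; elim/quotW=> b; elim/quotW=> c; uq_lift; constructor. Qed.
Lemma uq_addC : commutative uq_add.
Proof. by elim/quotW=> a; elim/quotW=> b; uq_lift; constructor. Qed.
Lemma uq_add0 : left_id uq_zero uq_add.
Proof. by elim/quotW=> a; uq_lift; constructor. Qed.
Lemma uq_addN : left_inverse uq_zero uq_opp uq_add.
Proof. by elim/quotW=> a; uq_lift; constructor. Qed.
Lemma uq_mulA : associative uq_mul.
Proof. by elim/quotW=> a; elim/quotW=> b; elim/quotW=> c; uq_lift; constructor. Qed.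
Lemma uq_1mul : left_id uq_one uq_mul.
Proof. by elim/quotW=> a; uq_lift; constructor. Qed.
Lemma uq_mul1 : right_id uq_one uq_mul.
Proof.
elim/quotW=> a; uq_lift; apply: (rel_trans (b := Scal 1 ⊗ a)); last exact: rel_1mul.
by apply: rel_sym; exact: rel_scalC.
Qed.
Lemma uq_mulDl : left_distributive uq_mul uq_add.
Proof. by elim/quotW=> a; elim/quotW=> b; elim/quotW=> c; uq_lift; constructor. Qed.
Lemma uq_mulDr : right_distributive uq_mul uq_add.
Proof. by elim/quotW=> a; elim/quotW=> b; elim/quotW=> c; uq_lift; constructor. Qed.

Fixpoint uq_eval (A : algType K) (g : uq_gen -> A) (a : T) : A :=
  match a with
  | Gen x => g x
  | Scal k => k%:A
  | Add a b => uq_eval g a + uq_eval g b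
  | Mul a b => uq_eval g a * uq_eval g b
  end.

Definition uq_relations (A : algType K) (g : uq_gen -> A) :=
  [/\ p *: (g gI * g gT2) - p^-1 *: (g gT2 * g gI) = g gT1,
      p *: (g gT1 * g gI) - p^-1 *: (g gI * g gT1) = g gT2 &
      p *: (g gT2 * g gT1) - p^-1 *: (g gT1 * g gT2) = 0].

Lemma uq_eval_rel (A : algType K) (g : uq_gen -> A) a b :
  uq_relations g -> uq_rel a b -> uq_eval g a = uq_eval g b.
Proof.
case=> g1 g2 g3; elim=> {a b} //=.
- by move=> b a c _ -> _ ->.
- by move=> a a' b b' _ -> _ ->.
- by move=> a a' b b' _ -> _ ->.
- by move=> a b c; rewrite addrA.
- by move=> a b; rewrite addrC.
- by move=> a; rewrite scale0r add0r.
- by move=> a; rewrite scaleN1r mulN1r scale0r addNr.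
- by move=> a b c; rewrite mulrA.
- by move=> a; rewrite scale1r mul1r.
- by move=> a b c; rewrite mulrDl.
- by move=> a b c; rewrite mulrDr.
- by move=> k l; rewrite scalerDl.
- by move=> k l; rewrite -scalerAl mul1r scalerA.
- by move=> k a; rewrite -scalerAl mul1r -scalerAr mulr1.
- by rewrite -!scalerAl !mul1r scaleNr.
- by rewrite -!scalerAl !mul1r scaleNr.
- by rewrite -!scalerAl !mul1r scaleNr scale0r.
Qed.

Lemma uq_one_neq0 : uq_one != uq_zero.
Proof.
apply/eqP=> /uq_clsP /(@uq_eval_rel K^o (fun=> 0)) /= H.
suff /eqP : (1 : K) = 0 by rewrite oner_eq0.
have := H _; rewrite /GRing.scale /= mulr1 mul0r; apply.
by split; rewrite /= ?mulr0 ?scaler0 ?subr0.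
Qed.

HB.instance Definition _ := GRing.isZmodule.Build Uiso2
  uq_addA uq_addC uq_add0 uq_addN.
HB.instance Definition _ := GRing.Zmodule_isNzRing.Build Uiso2
  uq_mulA uq_1mul uq_mul1 uq_mulDl uq_mulDr uq_one_neq0.

Lemma uq_scalerA k l x : uq_scale k (uq_scale l x) = uq_scale (k * l) x.
Proof.
rewrite /uq_scale uq_mulA; congr uq_mul.
by rewrite uq_mulE; apply/uq_clsP/rel_sym; exact: rel_scalM.
Qed.
Lemma uq_scale1r : left_id 1 uq_scale. Proof. exact: uq_1mul. Qed.
Lemma uq_scalerDr : right_distributive uq_scale +%R.
Proof. by move=> k; exact: uq_mulDr. Qed.
Lemma uq_scalerDl (x : Uiso2) : {morph uq_scale^~ x : k l / k + l}.
Proof.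
move=> k l; rewrite -[RHS](uq_mulDl (cls (Scal k)) (cls (Scal l)) x) uq_addE.
congr uq_mul.
by apply/uq_clsP; exact: rel_scalD.
Qed.
HB.instance Definition _ := GRing.Zmodule_isLmodule.Build K Uiso2
  uq_scalerA uq_scale1r uq_scalerDr uq_scalerDl.

Lemma uq_scalerAl k (x y : Uiso2) : k *: (x * y) = (k *: x) * y.
Proof. exact: uq_mulA. Qed.
HB.instance Definition _ := GRing.Lmodule_isLalgebra.Build K Uiso2 uq_scalerAl.

Lemma uq_scalerAr k (x y : Uiso2) : k *: (x * y) = x * (k *: y).
Proof.
suff H : forall z : Uiso2, uq_mul (cls (Scal k)) z = uq_mul z (cls (Scal k)).
  rewrite {1}/GRing.scale /= /uq_scale H -[RHS]/(uq_mul x (uq_mul _ y)) H.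
  by rewrite uq_mulA.
by elim/quotW=> a; uq_lift; constructor.
Qed.
HB.instance Definition _ := GRing.Lalgebra_isAlgebra.Build K Uiso2 uq_scalerAr.

Definition uq (x : uq_gen) : Uiso2 := cls (Gen x).

Lemma uq_rels : uq_relations uq.
Proof.
have cE a b : cls a + cls b = cls (a ⊕ b) by exact: uq_addE.
have mE a b : cls a * cls b = cls (a ⊗ b) by exact: uq_mulE.
have sE k a : k *: cls a = cls (Scal k ⊗ a) by exact: uq_mulE.
by split; rewrite -scaleNr /uq !(mE, sE, cE); apply/uq_clsP; constructor.
Qed.

Lemma uq_ind (P : Uiso2 -> Prop) :
  (forall x, P (uq x)) -> (forall k, P k%:A) ->
  (forall x y, P x -> P y -> P (x + y)) ->
  (forall x y, P x -> P y -> P (x * y)) -> forall x, P x.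
Proof.
move=> Pg Ps Pa Pm; elim/quotW; elim=> [x|k|a Pa' b Pb|a Pa' b Pb].
- exact: Pg.
- by have := Ps k; rewrite [k%:A](uq_mul1 (cls (Scal k))).
- by rewrite -uq_addE; exact: Pa.
- by rewrite -uq_mulE; exact: Pm.
Qed.

Lemma uq_universal (A : algType K) (g : uq_gen -> A) : uq_relations g ->
  exists f : {lrmorphism Uiso2 -> A}, forall x, f (uq x) = g x.
Proof.
move=> gP; pose f (x : Uiso2) := uq_eval g (repr x).
have fE a : f (cls a) = uq_eval g a by apply: uq_eval_rel => //; exact: uq_repr.
have fl : linear f.
  move=> k; elim/quotW=> a; elim/quotW=> b.
  rewrite [k *: _]uq_mulE [_ + _]uq_addE !fE /=.
  by rewrite -scalerAl mul1r.
have fm : monoid_morphism f.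
  split; first by rewrite fE /= scale1r.
  by elim/quotW=> a; elim/quotW=> b; rewrite [_ * _]uq_mulE !fE.
pose L := GRing.isLinear.Build K Uiso2 A _ f fl.
pose M := GRing.isMonoidMorphism.Build Uiso2 A f fm.
pose F : {lrmorphism Uiso2 -> A} := HB.pack f L M.
by exists F => x; rewrite /= fE.
Qed.

End Algebra.

Record hilbertType (R : realType) := HilbertType {
  hilbert_space :> completeNormedModType R[i];
  dotp : {dot hilbert_space for conjC};
  dotp_norm : forall x : hilbert_space, dotp x x = `|x| ^+ 2
}.

Section Linear.
Variables (K : fieldType) (V : lmodType K).

Definition linear_subspace (W : set V) :=
  W 0 /\ forall (k : K) u v, W u -> W v -> W (k *: u + v).

Definition lin (S : set V) : set V :=
  [set v | exists (n : nat) (c : 'I_n -> K) (w : 'I_n -> V),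
     (forall i, S (w i)) /\ v = \sum_(i < n) c i *: w i].

Definition finite_dimensional (W : set V) :=
  exists (n : nat) (b : 'I_n -> V), W `<=` lin (range b).

End Linear.

Definition orthonormal_basis (R : realType) (H : hilbertType R) (J : eqType)
    (e : J -> H) :=
  (forall i j, dotp H (e i) (e j) = (i == j)%:R) /\ dense (lin (range e)).

Section Representations.
Variables (R : realType) (p : R[i]).

(* Homomorphisms from the algebra into the linear operators of H with dense
   invariant domain dom; the values of op a outside dom are irrelevant. *)
Record domain_rep (H : hilbertType R) := DomainRep {
  dom : set H;
  op : Uiso2 p -> H -> H;
  dom_subspace : linear_subspace dom;
  dom_dense : dense dom;
  op_dom : forall a v, dom v -> dom (op a v);
  op_linear : forall a (k : R[i]) u v, dom u -> dom v ->
    op a (k *: u + v) = k *: op a u + op a v;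
  op_add : forall a b v, dom v -> op (a + b) v = op a v + op b v;
  op_scale : forall (k : R[i]) a v, dom v -> op (k *: a) v = k *: op a v;
  op_one : forall v, dom v -> op 1 v = v;
  op_mul : forall a b v, dom v -> op (a * b) v = op a (op b v)
}.

Definition invariant_subspace (H : hilbertType R) (pi : domain_rep H)
    (W : set H) :=
  [/\ linear_subspace W, W `<=` dom pi & forall a v, W v -> W (op pi a v)].

Definition irreducible (H : hilbertType R) (pi : domain_rep H) :=
  dom pi <> [set 0] /\
  forall W, invariant_subspace pi W -> W = [set 0] \/ W = dom pi.

Definition eigenspaceI (H : hilbertType R) (pi : domain_rep H) (l : R[i]) :
    set H :=
  [set v | dom pi v /\ op pi (uq p gI) v = l *: v].

(* Discrete spectrum means pure point spectrum: the eigenvalues of op I may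
   accumulate in the complex plane, as they do when |q| = 1. *)
Record representation (H : hilbertType R) := Representation {
  rep :> domain_rep H;
  rep_span : dom rep =
    lin [set v | v != 0 /\ exists l, eigenspaceI rep l v];
  rep_finite : irreducible rep ->
    forall l, finite_dimensional (eigenspaceI rep l)
}.

Definition equivalent (H H' : hilbertType R) (pi : representation H)
    (pi' : representation H') :=
  exists (V : set H) (V' : set H') (A : H -> H'),
    [/\ invariant_subspace pi V /\ dense V,
        invariant_subspace pi' V' /\ dense V',
        forall (k : R[i]) u v, V u -> V v -> A (k *: u + v) = k *: A u + A v,
        set_bij V V' A &
        forall a v, V v -> A (op pi a v) = op pi' a (A v)].

Definition one_dimensional (H : hilbertType R) (pi : representation H) :=
  exists v : H, v != 0 /\ dom pi = lin [set v].

Definition is_Rrs (q r s : R[i]) (H : hilbertType R) (pi : representation H) :=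
  exists e : int -> H, [/\ orthonormal_basis e, dom pi = lin (range e) &
    forall m : int,
    [/\ op pi (uq p gI) (e m) =
          ('i * ((s * q ^ m - s^-1 * q ^ (- m)) / (q - q^-1))) *: e m,
        op pi (uq p gT2) (e m) =
          (r / (s * q ^ m + s^-1 * q ^ (- m))) *: (e (m + 1) + e (m - 1)) &
        op pi (uq p gT1) (e m) =
          ('i * p * r / (s * q ^ m + s^-1 * q ^ (- m))) *:
            ((s * q ^ m) *: e (m + 1) - (s^-1 * q ^ (- m)) *: e (m - 1))]].

(* The Hilbert space completion of the span of the basis vectors is taken for
   the inner product that makes these vectors orthonormal. *)
Definition is_Rr (q r eps teps : R[i]) (H : hilbertType R)
    (pi : representation H) :=
  exists e : nat -> H, [/\ orthonormal_basis e, dom pi = lin (range e),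
    forall j : nat,
      op pi (uq p gI) (e j) =
        (- eps * ((q ^+ j * p + q ^- j * p^-1) / (q - q^-1))) *: e j,
    op pi (uq p gT2) (e 0%N) =
      (- eps * (r / (p - p^-1))) *: (teps *: e 0%N + 'i *: e 1%N) /\
    (forall j : nat, (1 <= j)%N ->
      op pi (uq p gT2) (e j) =
        (- eps * ('i * r / (q ^+ j * p - q ^- j * p^-1))) *:
          (e j.+1 + e j.-1)) &
    op pi (uq p gT1) (e 0%N) =
      (r / (p - p^-1)) *: (teps *: e 0%N + ('i * q) *: e 1%N) /\
    (forall j : nat, (1 <= j)%N ->
      op pi (uq p gT1) (e j) =
        ('i * r / (q ^+ j * p - q ^- j * p^-1)) *:
          (q ^+ j.+1 *: e j.+1 + q ^- j *: e j.-1))].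

End Representations.

(* Main.v *)
Require Import Defs.
From mathcomp Require Import all_boot all_order all_algebra.
From HB Require Import structures.
From mathcomp Require Import ring.
From mathcomp Require Import complex.
From mathcomp Require Import all_classical all_reals all_analysis.

(** Let w(s) = i (s - s^-1) / (q - q^-1); every complex number is some w(s),
    and w(s) = w(-s^-1) is the only coincidence ([weight_surj], [weight_eq]).
    On a vector v with I v = w(s) v, the combinations of T1 and T2

      raise s v = s^-1 T2 v - (i / p) T1 v,  lower s v = s T2 v + (i / p) T1 v

    are eigenvectors of I for w(s q) and w(s q^-1), and
    (s + s^-1) T2 v = raise s v + lower s v.  The element
    q T2^2 + q^-1 T1^2 - p (q - q^-1) T2 T1 I is central, and on v it equals
    both lower (s q) (raise s v) and raise (s q^-1) (lower s v).  As the
    eigenspaces of I are finite-dimensional, it acts on an irreducible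
    representation by a scalar c ([casimir_scalar]).

    If c = 0, the representation is one-dimensional ([one_dim_of_casimir0]).
    When s^2 <> - q^-k for all k >= 1, the vectors raise^k v with k >= 1 span
    an invariant subspace on which I does not have the eigenvalue w(s), so
    raise s v = 0 ([raise_eq0]).  Either s or -s^-1 satisfies this condition.
    If both do and s^2 <> -1, v is killed by T2.  Otherwise s^2 = - q^n with
    n >= 0 up to exchanging s and -s^-1, and lowering v until it vanishes or
    n is 0 or 1 leads to a vector that T2 kills ([one_dim_degenerate]).

    If c = r^2 <> 0, raising and lowering never kill a vector, so v generates
    a chain of eigenvectors with parameters s q^m, m an integer.  In this case
    s^2 = -1 cannot occur: then w(s q) = w(s q^-1), and diagonalizability of I
    forces raise s v = 0 ([sqr_neqN1]).  If s^2 <> - q^n for all integers n,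
    the chain is a basis and the formulas of R_rs hold ([zchain_Rrs]).
    Otherwise n is odd, and moving along the chain gives s^2 = - q.  There
    w(s q^-1) = w(s), so that lower s maps the eigenspace of w(s) to itself;
    its square is -c.  The chain raised from an eigenvector of lower s is a
    basis in which the formulas of R_r hold ([chain_Rr]).

    It remains to realize these formulas in an orthonormal basis
    ([realization]).  No new Hilbert space is needed.  The basis found
    is a countable algebraic basis of the dense domain in H.  The Gram-Schmidt
    process gives an orthonormal basis of H with the same span, and the linear
    bijection that sends one basis to the other transports the representation
    to an equivalent one on the same domain. *)

Set Implicit Arguments.
Unset Strict Implicit.
Unset Printing Implicit Defensive.

Import Order.TTheory GRing.Theory Num.Theory.
Import numFieldNormedType.Exports.
Local Open Scope classical_set_scope.
Local Open Scope complex_scope.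
Local Open Scope ring_scope.

(** * Spans and linear combinations *)
Section Spans.
Variables (K : fieldType) (V : lmodType K).
Implicit Types (S W : set V) (b : nat -> V) (P Q : {poly K}).

Lemma subspace0 W : linear_subspace W -> W 0.
Proof. by case. Qed.

Lemma subspaceZ W k v : linear_subspace W -> W v -> W (k *: v).
Proof. by move=> [W0 Wl] Wv; rewrite -[_ *: _]addr0; apply: Wl. Qed.

Lemma subspaceD W u v : linear_subspace W -> W u -> W v -> W (u + v).
Proof. by move=> [W0 Wl] Wu Wv; rewrite -[u]scale1r; apply: Wl. Qed.

Lemma subspaceB W u v : linear_subspace W -> W u -> W v -> W (u - v).
Proof.
move=> sW Wu Wv; apply: subspaceD => //; rewrite -scaleN1r.
exact: subspaceZ.
Qed.

Lemma subspace_sum W (J : Type) (s : seq J) (F : J -> V) :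
  linear_subspace W -> (forall j, W (F j)) -> W (\sum_(j <- s) F j).
Proof.
move=> sW WF; elim/big_ind: _ => //; first by case: sW.
by move=> x y; apply: subspaceD.
Qed.

Lemma lin_subspace S : linear_subspace (lin S).
Proof.
split; first by exists 0%N, (fun=> 0), (fun=> 0); split;
  [case|rewrite big_ord0].
move=> k u v [m [c [x [Sx ->]]]] [n [d [y [Sy ->]]]].
exists (m + n)%N, (fun i => match fintype.split i with inl j =>
  k * c j | inr j => d j end),
  (fun i => match fintype.split i with inl j => x j | inr j => y j end); split.
  by move=> i; case: (fintype.split i).
rewrite big_split_ord /= scaler_sumr; congr (_ + _); apply: eq_bigr => i _.
  by rewrite (unsplitK (inl i : 'I_m + 'I_n)%type) scalerA.
by rewrite (unsplitK (inr i : 'I_m + 'I_n)%type).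
Qed.

Lemma sub_lin S : S `<=` lin S.
Proof.
move=> v Sv; exists 1%N, (fun=> 1), (fun=> v); split=> //.
by rewrite big_ord1 scale1r.
Qed.

Lemma lin_least S W : linear_subspace W -> S `<=` W -> lin S `<=` W.
Proof.
move=> sW SW v [n [c [w [Sw ->]]]]; apply: subspace_sum => // i.
by apply: subspaceZ => //; apply: SW.
Qed.

Lemma lin_image S W (f : {linear V -> V}) :
  linear_subspace W -> (forall v, S v -> W (f v)) -> forall v, lin S v ->
    W (f v).
Proof.
move=> sW SW; apply: lin_least => //; split; first by rewrite /= linear0;
  exact: subspace0.
by move=> k u v Wu Wv; rewrite /= linearP; apply: (proj2 sW).
Qed.

Lemma lin_ord (n : nat) (b : 'I_n -> V) v :
  lin (range b) v -> exists c, v = \sum_(i < n) c i *: b i.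
Proof.
apply: (@lin_least _ [set v | exists c, v = \sum_(i < n) c i *: b i]).
  split=> [|k u w [c ->] [d ->]].
    by exists (fun=> 0); rewrite big1 // => i _; rewrite scale0r.
  exists (fun i => k * c i + d i); rewrite scaler_sumr -big_split.
  by apply: eq_bigr => i _; rewrite scalerA scalerDl.
move=> w [i _ <-]; exists (fun j => (j == i)%:R).
by rewrite (bigD1 i) //= eqxx scale1r big1 ?addr0 // => j /negPf->;
  rewrite scale0r.
Qed.

(** This makes induction on the number of generators possible. *)
Lemma lin_cons x (s : seq V) v :
  lin [set` x :: s] v <-> exists k, lin [set` s] (v - k *: x).
Proof.
have sL := lin_subspace [set` s]; have sL' := lin_subspace [set` x :: s].
split=> [|[k sv]].
  apply: (@lin_least _ [set v | exists k, lin [set` s] (v - k *: x)]) =>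
    [|y /=].
    split=> [|k y z [a ya] [b zb]]; first by exists 0; rewrite scale0r subr0;
      exact: subspace0.
    exists (k * a + b); rewrite scalerDl opprD addrACA -scalerA -scalerBr.
    exact: (proj2 sL).
  rewrite inE => /predU1P[->|ys]; first by exists 1; rewrite scale1r subrr;
    exact: subspace0.
  by exists 0; rewrite scale0r subr0; apply: sub_lin.
rewrite -[v](subrK (k *: x)); apply: subspaceD => //; last first.
  by apply: subspaceZ => //; apply: sub_lin; rewrite /= mem_head.
by apply: lin_least sv => // y ys; apply: sub_lin; rewrite /= inE ys orbT.
Qed.

(** A finite-dimensional subspace is by definition contained in the span of
    finitely many vectors, which may lie outside it.  Generators inside it are
    needed to apply maps that are only linear on the subspace.  Removing one
    generator x at a time, a single vector of W with nonzero coordinate on x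
    makes up for the loss of x. *)
Lemma finite_dimensional_generators W : linear_subspace W ->
  finite_dimensional W ->
  exists s : seq V, {in s, forall x, W x} /\ W `<=` lin [set` s].
Proof.
move=> sW [n [b Wb]].
have {n b Wb} [s Ws] : exists s : seq V, W `<=` lin [set` s].
  exists (codom b) => w /Wb; apply: lin_least; first exact: lin_subspace.
  by move=> _ [i _ <-]; apply: sub_lin; exact: codom_f.
elim: s W sW Ws => [|x s IH] W sW Ws; first by exists [::].
pose W' := W `&` lin [set` s].
have [||s' [W's' sub's']] := IH W'; last first.
- have [[w Ww w_s]|nw] := EM (exists2 w, W w & ~ lin [set` s] w); last first.
    exists s'; split=> [y /W's'[]//|w Ww]; apply: sub's'; split=> //.
    by apply: contrapT => nsw; apply: nw; exists w.
  have [k skw] := (proj1 (lin_cons x s w)) (Ws w Ww).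
  have k0 : k != 0 by apply/eqP => k0; apply: w_s; move: skw;
    rewrite k0 scale0r subr0.
  exists (w :: s'); split=> [y|y Wy];
    first by rewrite inE => /predU1P[->|/W's'[]].
  have [l sly] := (proj1 (lin_cons x s y)) (Ws y Wy).
  apply/lin_cons; exists (l / k); apply: sub's'; split.
    by apply: subspaceB => //; exact: subspaceZ.
  have -> : y - (l / k) *: w = (y - l *: x) - (l / k) *: (w - k *: x).
    by rewrite scalerBr scalerA divfK // opprB addrA subrK.
  apply: subspaceB => //; first exact: lin_subspace.
  by apply: subspaceZ => //; exact: lin_subspace.
- by move=> y [].
- have sL := lin_subspace [set` s]; split; first by split; exact: subspace0.
  by move=> k u v [Wu su] [Wv sv]; split; [exact: (proj2 sW)|exact: (proj2 sL)].
Qed.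

(** Polynomials serve as the free vector space on a countable basis: [lcomb b]
    is the linear map that sends the monomial of degree i to [b i]. *)
Definition lcomb b P : V := \sum_(i < size P) P`_i *: b i.

Lemma lcomb_widen b P n : (size P <= n)%N ->
  lcomb b P = \sum_(i < n) P`_i *: b i.
Proof.
move=> le_n; rewrite /lcomb (big_ord_widen n (fun i => P`_i *: b i) le_n).
rewrite big_mkcond; apply: eq_bigr => i _; case: ltnP => // le_i.
by rewrite nth_default ?scale0r.
Qed.

Lemma lcomb_linear b : linear (lcomb b).
Proof.
move=> k P Q; set n := maxn (size P) (size Q).
rewrite !(@lcomb_widen _ _ n) ?leq_maxl ?leq_maxr //; last first.
  rewrite (leq_trans (size_polyD _ _)) // geq_max leq_maxr andbT.
  by rewrite (leq_trans (size_scale_leq _ _)) ?leq_maxl.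
rewrite scaler_sumr -big_split; apply: eq_bigr => i _.
by rewrite coefD coefZ scalerDl scalerA.
Qed.

HB.instance Definition _ b :=
  GRing.isLinear.Build K {poly K} V _ (lcomb b) (lcomb_linear b).

Lemma lcombXn b i : lcomb b 'X^i = b i.
Proof.
rewrite (@lcomb_widen _ _ i.+1) ?size_polyXn // big_ord_recr /= coefXn eqxx.
rewrite scale1r big1 ?add0r // => j _.
by rewrite coefXn ltn_eqF ?scale0r.
Qed.

Lemma lcombMX b P : lcomb b (P * 'X) = lcomb (b \o S) P.
Proof.
rewrite (@lcomb_widen _ _ (size P).+1) ?(leq_trans (size_polyMleq _ _))
  ?size_polyX ?addn2 //.
rewrite big_ord_recl coefMX eqxx scale0r add0r.
by apply: eq_bigr => i _; rewrite coefMX.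
Qed.

Lemma lcomb_range b : range (lcomb b) = lin (range b).
Proof.
apply/seteqP; split=> [_ [P _ <-]|].
  apply: subspace_sum; first exact: lin_subspace.
  move=> i; apply: subspaceZ; first exact: lin_subspace.
  by apply: sub_lin; exists i.
apply: lin_least => [|_ [i _ <-]]; last by exists 'X^i => //; rewrite lcombXn.
split; first by exists 0 => //; rewrite linear0.
by move=> k _ _ [P _ <-] [Q _ <-]; exists (k *: P + Q); rewrite ?linearP.
Qed.

End Spans.

(** * Eigenvectors of a linear map *)
Section Eigenvectors.
Variables (K : fieldType) (V : lmodType K) (f : {linear V -> V}).
Implicit Types (mu : K) (v w : V).

Definition shifts (s : seq K) v := foldr (fun a w => f w - a *: w) v s.

Lemma shifts_eig s l v : f v = l *: v ->
  shifts s v = (\prod_(a <- s) (l - a)) *: v.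
Proof.
move=> fv; elim: s => [|a s IH] /=; first by rewrite big_nil scale1r.
by rewrite IH big_cons linearZ /= fv !scalerA -scalerBl mulrC -mulrBl.
Qed.

Lemma shifts_sum s (J : Type) (t : seq J) (F : J -> V) :
  shifts s (\sum_(j <- t) F j) = \sum_(j <- t) shifts s (F j).
Proof.
elim: s => //= a s ->.
by rewrite linear_sum scaler_sumr -sumrB.
Qed.

(** The product of the maps f - l, for the eigenvalues l of the summands,
    kills v, while it multiplies v by the nonzero scalar prod (mu - l). *)
Lemma eig_sep mu v :
  lin [set w | exists2 l, l != mu & f w = l *: w] v -> f v = mu *: v -> v = 0.
Proof.
move=> [n [c [w [Sw ev]]]] fv.
have /choice[l hl] : forall i, exists l, l != mu /\ f (w i) = l *: w i.
  by move=> i; have [x] := Sw i; exists x.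
pose s := [seq l i | i <- enum 'I_n].
have : shifts s v = 0.
  rewrite {1}ev shifts_sum big1 // => i _.
  have [_ fw] := hl i.
  rewrite (@shifts_eig _ (l i)); last by rewrite linearZ /= fw !scalerA mulrC.
  rewrite (big_rem (l i)) /=; first by rewrite subrr mul0r scale0r.
  by apply: map_f; rewrite mem_enum.
rewrite (@shifts_eig _ mu) // => /eqP.
rewrite scaler_eq0 => /orP[|/eqP//];
  rewrite prodf_seq_eq0 => /hasP[_ /mapP[i _ ->]] /=.
by rewrite subr_eq0 eq_sym; have [/negPf-> _] := hl i.
Qed.

(** The vector f v - mu v is a combination of eigenvectors with eigenvalues
    other than mu, so it vanishes if it lies in the eigenspace of mu. *)
Lemma eig_semisimple mu v :
  lin [set w | exists l, f w = l *: w] v ->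
  f (f v - mu *: v) = mu *: (f v - mu *: v) -> f v = mu *: v.
Proof.
set S := [set w | exists2 l, l != mu & f w = l *: w].
have sL : linear_subspace (lin S) := lin_subspace S.
move=> lv fu; apply/eqP; rewrite -subr_eq0; apply/eqP; apply: eig_sep fu.
move: v lv; apply: lin_least.
  split=> [|k u v hu hv] /=.
    by rewrite linear0 scaler0 subr0; exact: subspace0 sL.
  have -> : f (k *: u + v) - mu *: (k *: u + v) = k *: (f u - mu *: u) + (f v -
    mu *: v).
    by rewrite linearP /= scalerDr opprD addrACA scalerBr !scalerA [mu *
      k]mulrC.
  exact: (proj2 sL).
move=> w [l fw] /=; have [lE|lmu] := eqVneq l mu.
  by rewrite fw lE subrr; exact: subspace0 sL.
apply: sub_lin; exists l => //.
by rewrite fw -scalerBl linearZ /= fw !scalerA mulrC.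
Qed.

Lemma eig_free (b : nat -> V) (l : nat -> K) :
  injective l -> (forall i, f (b i) = l i *: b i) -> (forall i, b i != 0) ->
  forall P, lcomb b P = 0 -> P = 0.
Proof.
move=> injl fb b0 P eP; apply/polyP => i; rewrite coef0.
have [lt_i|] := ltnP i (size P); last exact: nth_default.
suff /eqP : P`_i *: b i = 0 by rewrite scaler_eq0 (negPf (b0 i)) orbF => /eqP.
apply: (@eig_sep (l i)); last by rewrite linearZ /= fb !scalerA mulrC.
have := eP; rewrite /lcomb (bigD1 (Ordinal lt_i)) //= => /eqP.
rewrite addr_eq0 => /eqP ->; rewrite -sumrN big_mkcond /=.
have sL := lin_subspace [set w | exists2 l0, l0 != l i & f w = l0 *: w].
apply: subspace_sum => // j; case: ifP => [ji|_]; last by case: sL.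
rewrite -scaleNr; apply: subspaceZ => //; apply: sub_lin; exists (l j) => //.
by apply: contra ji => /eqP/injl/eqP; apply.
Qed.

End Eigenvectors.

Section EigenvectorExists.
Variables (K : closedFieldType) (V : lmodType K) (f : {linear V -> V}).

(** Induction on the degree: a linear factor X - a of P either yields an
    eigenvector, or is removed by passing from v to f v - a v. *)
Lemma poly_eigenvector (W : set V) (P : {poly K}) v :
  linear_subspace W -> (forall w, W w -> W (f w)) -> W v -> v != 0 -> P != 0 ->
  lcomb (fun k => iter k f v) P = 0 ->
  exists a w, [/\ W w, w != 0 & f w = a *: w].
Proof.
move=> sW Wf; elim: {P}(size P) {-2}P (erefl (size P)) v =>
  [|n IH] P szP v Wv v0 P0 eP.
  by move/eqP: szP; rewrite size_poly_eq0 (negPf P0).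
have [n0|n0] := eqVneq n 0%N.
  move: eP; rewrite /lcomb szP n0 big_ord1 /= => /eqP.
  rewrite scaler_eq0 (negPf v0) orbF => /eqP P00; case/eqP: P0.
  by apply/polyP=> -[|i]; rewrite ?P00 ?coef0 // nth_default // szP n0.
have [a /factor_theorem[Q PE]] : exists a, root P a.
  by apply/closed_rootP; rewrite szP eqSS.
have Q0 : Q != 0 by apply: contraNneq P0 => Q0; rewrite PE Q0 mul0r.
have szQ : size Q = n.
  by apply/eqP; rewrite -eqSS -szP PE size_Mmonic ?monicXsubC //
    size_XsubC addn2.
have [fv|fv] := eqVneq (f v - a *: v) 0.
  by exists a, v; split=> //; apply/eqP; rewrite -subr_eq0 fv.
apply: (IH Q szQ (f v - a *: v)) => //.
  by apply: subspaceB => //; [exact: Wf|exact: subspaceZ].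
have fk k : iter k f (f v - a *: v) = iter k.+1 f v - a *: iter k f v.
  by elim: k => //= k ->; rewrite linearB linearZ /=.
rewrite -eP PE mulrBr [Q * a%:P]mulrC mul_polyC [RHS]linearB /=.
rewrite [lcomb _ (a *: Q)]linearZ /= lcombMX /lcomb scaler_sumr -sumrB;
  apply: eq_bigr => i _.
by rewrite fk scalerBr !scalerA mulrC.
Qed.

(** Among n generators, the n + 1 vectors v, f v, .., f^n v are linearly
    dependent, so a nonzero polynomial in f kills v. *)
Lemma fin_dim_eigenvector (W : set V) v :
  linear_subspace W -> finite_dimensional W -> (forall w, W w -> W (f w)) ->
  W v -> v != 0 -> exists a w, [/\ W w, w != 0 & f w = a *: w].
Proof.
move=> sW [n [b Wb]] Wf Wv v0.
have /choice[M HM] : forall k : 'I_n.+1, exists c : 'I_n ->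
  K, iter k f v = \sum_(j < n) c j *: b j.
  move=> k; apply: lin_ord; apply: Wb; elim: (val k) => //= m; exact: Wf.
pose A : 'M[K]_(n.+1, n) := \matrix_(k, j) M k j.
have : kermx A != 0.
  rewrite -mxrank_eq0 mxrank_ker -lt0n subn_gt0 ltnS; exact: rank_leq_col.
case/rowV0Pn=> u /sub_kermxP uA u0.
apply: (@poly_eigenvector W (\poly_(k < n.+1) u 0 (inord k)) v) => //.
  apply: contraNneq u0 => P0; apply/eqP/rowP => k.
  have := congr1 (fun P : {poly K} => P`_k) P0.
  by rewrite coef_poly ltn_ord inord_val coef0 mxE.
rewrite (@lcomb_widen _ _ _ _ n.+1) ?size_poly //.
transitivity (\sum_(j < n) (u *m A) 0 j *: b j); last first.
  by rewrite uA big1 // => j _; rewrite mxE scale0r.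
under [RHS]eq_bigr do rewrite mxE scaler_suml.
rewrite exchange_big; apply: eq_bigr => k _ /=.
rewrite coef_poly ltn_ord inord_val HM scaler_sumr; apply: eq_bigr => j _.
by rewrite mxE scalerA.
Qed.

End EigenvectorExists.

(** * Identities in a module, by comparing coefficients *)
Section LinearExpressions.
Variables (K : pzRingType) (V : lmodType K).

(** Linear expressions in a list of vectors, reified so that an identity
    between them reduces to scalar identities that [ring] and [field] solve. *)
Inductive vexpr :=
| VAtom of nat
| VOpp of vexpr
| VAdd of vexpr & vexpr
| VScale of K & vexpr.

Fixpoint veval (env : seq V) e : V :=
  match e with
  | VAtom i => env`_i
  | VOpp e => - veval env e
  | VAdd e e' => veval env e + veval env e'
  | VScale k e => k *: veval env e
  end.

Fixpoint vcoef (i : nat) e : K :=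
  match e with
  | VAtom j => (i == j)%:R
  | VOpp e => - vcoef i e
  | VAdd e e' => vcoef i e + vcoef i e'
  | VScale k e => k * vcoef i e
  end.

Lemma vevalE env e : veval env e = \sum_(i < size env) vcoef i e *: env`_i.
Proof.
elim: e => /= [j|e ->|e -> e' ->|k e ->].
- have [lt_j|le_j] := ltnP j (size env).
    rewrite (bigD1 (Ordinal lt_j)) //= eqxx scale1r big1 ?addr0 // =>
      i /negPf ij.
    by rewrite -[_ == j]/(i == Ordinal lt_j) ij scale0r.
  rewrite nth_default // big1 // => i _.
  by rewrite ltn_eqF ?scale0r // (leq_trans _ le_j).
- by rewrite -sumrN; apply: eq_bigr => i _; rewrite scaleNr.
- by rewrite -big_split; apply: eq_bigr => i _; rewrite scalerDl.
- by rewrite scaler_sumr; apply: eq_bigr => i _; rewrite scalerA.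
Qed.

Lemma veval_eq env e e' :
  foldr (fun i P => vcoef i e = vcoef i e' /\ P) True (iota 0 (size env)) ->
  veval env e = veval env e'.
Proof.
move=> eqc; rewrite !vevalE; apply: eq_bigr => i _; congr (_ *: _).
have : val i \in iota 0 (size env) by rewrite mem_iota add0n /=.
elim: (iota _ _) eqc => //= j s IH [jE sE].
by rewrite inE => /orP[/eqP->|] //; exact: IH.
Qed.

End LinearExpressions.

(* Vectors are matched up to unification because rewriting with linearity leaves
   different but convertible structure instances in the terms. *)
Ltac vindex env t :=
  match env with
  | ?x :: _ => let _ := match goal with _ => unify x t end in constr:(0%N)
  | _ :: ?env' => let i := vindex env' t in constr:(S i)
  end.

Ltac vreify env t :=
  lazymatch t with
  | (?a + ?b)%R => let x := vreify env a in let y := vreify env b in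
                   uconstr:(VAdd x y)
  | (- ?a)%R => let x := vreify env a in uconstr:(VOpp x)
  | (?k *: ?a)%R => let x := vreify env a in uconstr:(VScale k x)
  | _ => let i := vindex env t in uconstr:(VAtom _ i)
  end.

Tactic Notation "compare_coefficients" constr(env) :=
  lazymatch goal with |- ?a = ?b =>
    let x := vreify env a in let y := vreify env b in
    change (veval env x = veval env y); apply: veval_eq; rewrite /=;
      repeat split
  end.

(** * Algebraic classification *)

(** Indexing by the integers is reduced to indexing by the naturals. *)
Definition int_of_nat n : int := if odd n then Negz n./2 else Posz n./2.

Definition nat_of_int (m : int) :=
  match m with Posz n => n.*2 | Negz n => n.*2.+1 end.

Lemma int_of_natK : cancel int_of_nat nat_of_int.
Proof.
move=> n; rewrite /int_of_nat -[RHS]odd_double_half.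
by case: ifP => _ /=; rewrite ?add1n ?add0n.
Qed.

Lemma nat_of_intK : cancel nat_of_int int_of_nat.
Proof.
by case=> n; rewrite /int_of_nat /= odd_double /= ?uphalf_double ?doubleK.
Qed.

Section Classification.
Variables (C : numClosedFieldType) (p : C).
Let q := p ^+ 2.
Hypothesis p0 : p != 0.
Hypothesis q_not_root : forall n, (0 < n)%N -> q ^+ n != 1.

Implicit Types s t r c x : C.

Let qq0 : p ^+ 2 * p ^+ 2 - 1 != 0.
Proof. by rewrite subr_eq0 -expr2 q_not_root. Qed.

Definition weight (s : C) := 'i * ((s - s^-1) / (p ^+ 2 - p ^- 2)).

Lemma weight_dual s : weight (- s^-1) = weight s.
Proof. by rewrite /weight invrN invrK opprK addrC. Qed.

Lemma weight_eq s t : s != 0 -> t != 0 -> weight s = weight t ->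
  s = t \/ s * t = -1.
Proof.
move=> s0 t0 e.
have /eqP : (s - t) * (s * t + 1) = 0.
  transitivity ((weight s - weight t) * (s * t * (p ^+ 2 - p ^- 2) / 'i)).
    rewrite /weight; field; rewrite ?p0 ?s0 ?t0 ?qq0 ?neq0Ci //.
  by rewrite e subrr mul0r.
rewrite mulf_eq0 subr_eq0 addr_eq0 => /orP[/eqP|/eqP]; first by left.
by right.
Qed.

(** The equation for s is s^2 - x s - 1 = 0, whose roots are nonzero. *)
Lemma weight_surj l : exists2 s, s != 0 & weight s = l.
Proof.
pose x := l * (p ^+ 2 - p ^- 2) / 'i.
pose y := sqrtC (x ^+ 2 + 4); have y2 : y ^+ 2 = x ^+ 2 + 4 by rewrite sqrtCK.
pose s := (x + y) / 2.
have sx : s * (s - x) = 1.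
  have -> : s * (s - x) = (y ^+ 2 - x ^+ 2) / 4 by rewrite /s; field.
  by rewrite y2; field.
have s0 : s != 0 by apply: contra_eq_neq sx => ->;
  rewrite mul0r eq_sym oner_eq0.
exists s => //; rewrite /weight.
have -> : s^-1 = s - x by apply: (mulfI s0); rewrite sx divff.
rewrite /x; field; rewrite ?p0 ?qq0 ?neq0Ci //.
Qed.

Lemma qz_inj (m n : int) : q ^ m = q ^ n -> m = n.
Proof.
have q_neq0 : q != 0 by rewrite expf_neq0.
have q1 k : q ^+ k = 1 -> k = 0%N.
  by case: k => // k /eqP; rewrite (negPf (q_not_root _)).
move=> e; apply/eqP; rewrite -subr_eq0; apply/eqP.
have : q ^ (m - n) = 1 by rewrite expfzDr // e -expfzDr // subrr expr0z.
case: (m - n) => k; first by move/q1->.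
by rewrite NegzE -exprnN => /eqP; rewrite invr_eq1 => /eqP/q1.
Qed.

Lemma weight_inj s : s != 0 -> (forall m : int, s ^+ 2 * q ^ m != -1) ->
  injective (fun m : int => weight (s * q ^ m)).
Proof.
move=> s0 s2 m n /weight_eq; rewrite !mulf_neq0 ?expfz_neq0 ?expf_neq0 //.
case=> // [/(mulfI s0)/qz_inj//|/eqP].
by rewrite mulrACA -expr2 -expfzDr ?expf_neq0 // (negPf (s2 _)).
Qed.

Lemma weight_inj_nat t : t ^+ 2 = - q ->
  injective (fun j : nat => weight (t * q ^+ j)).
Proof.
move=> t2 m n; have q_neq0 : q != 0 by rewrite expf_neq0.
have t0 : t != 0 by rewrite -sqrf_eq0 t2 oppr_eq0.
move=> /weight_eq; rewrite !mulf_neq0 ?expf_neq0 //.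
case=> // [/(mulfI t0)|/eqP]; first by rewrite !exprnP => /qz_inj[].
by rewrite mulrACA -expr2 t2 -exprD mulNr eqr_opp -exprS (negPf (q_not_root _)).
Qed.

Variables (V : lmodType C) (I T1 T2 : {linear V -> V}).
Hypothesis relT1 : forall v, p *: I (T2 v) - p^-1 *: T2 (I v) = T1 v.
Hypothesis relT2 : forall v, p *: T1 (I v) - p^-1 *: I (T1 v) = T2 v.
Hypothesis relT12 : forall v, p *: T2 (T1 v) - p^-1 *: T1 (T2 v) = 0.

Let IT2 v : I (T2 v) = p^-1 *: T1 v + p ^- 2 *: T2 (I v).
Proof.
rewrite -relT1; compare_coefficients [:: I (T2 v); T2 (I v)]; field; exact: p0.
Qed.

Let IT1 v : I (T1 v) = p ^+ 2 *: T1 (I v) - p *: T2 v.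
Proof.
rewrite -relT2; compare_coefficients [:: T1 (I v); I (T1 v)]; field; exact: p0.
Qed.

Let T1T2 v : T1 (T2 v) = p ^+ 2 *: T2 (T1 v).
Proof.
rewrite -[LHS]addr0 -[X in _ + X](scaler0 _ p) -(relT12 v).
compare_coefficients [:: T1 (T2 v); T2 (T1 v)]; field; exact: p0.
Qed.

(** If I v = w(s) v and s^2 <> -1, then T2 v = X + Y and
    T1 v = i p (s X - s^-1 Y) with eigenvectors X and Y of I for w(s q) and
    w(s q^-1).  Solving for X and multiplying by s + s^-1 gives this formula,
    which has a meaning for s^2 = -1 too. *)
Definition raise s v := s^-1 *: T2 v - ('i / p) *: T1 v.

Lemma raise_linear s : linear (raise s).
Proof.
move=> k u v; rewrite /raise !linearP /=.
by compare_coefficients [:: T2 u; T2 v; T1 u; T1 v]; ring.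
Qed.
HB.instance Definition _ s :=
  GRing.isLinear.Build C V V _ (raise s) (raise_linear s).

(** Exchanging s and -s^-1 keeps the eigenvalue and exchanges the two
    directions, so statements on [lower] follow from those on [raise]. *)
Definition lower s v := - raise (- s^-1) v.

Lemma lowerE s v : lower s v = s *: T2 v + ('i / p) *: T1 v.
Proof. by rewrite /lower /raise invrN invrK scaleNr opprB opprK addrC. Qed.

Lemma lower_linear s : linear (lower s).
Proof. by move=> k u v; rewrite /lower (linearP (raise _)) opprD scalerN. Qed.
HB.instance Definition _ s :=
  GRing.isLinear.Build C V V _ (lower s) (lower_linear s).

Lemma T2_raise_lower s v : (s + s^-1) *: T2 v = raise s v + lower s v.
Proof.
by rewrite lowerE /raise; compare_coefficients [:: T2 v; T1 v]; ring.
Qed.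

Lemma T1_raise_lower s v : s != 0 ->
  (s + s^-1) *: T1 v = ('i * p) *: (s *: raise s v - s^-1 *: lower s v).
Proof.
move=> s0; rewrite lowerE /raise; compare_coefficients [:: T2 v; T1 v].
  by field; rewrite s0 p0.
by field: (sqrCi C); rewrite s0 p0.
Qed.

Lemma raise_eig s v : s != 0 -> I v = weight s *: v ->
  I (raise s v) = weight (s * p ^+ 2) *: raise s v.
Proof.
move=> s0 Iv; rewrite /raise linearB !linearZ /= IT1 IT2 Iv !linearZ /= /weight.
compare_coefficients [:: T2 v; T1 v]; field: (sqrCi C); rewrite ?s0 ?p0 ?qq0 //.
Qed.

Lemma lower_eig s v : s != 0 -> I v = weight s *: v ->
  I (lower s v) = weight (s / p ^+ 2) *: lower s v.
Proof.
move=> s0 Iv; rewrite /lower linearN /= raise_eig ?oppr_eq0 ?invr_eq0 //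
  ?weight_dual //.
by rewrite -[in RHS]weight_dual invf_div mulNr scalerN mulrC.
Qed.

(** T2 v is killed by (I - w(s q)) (I - w(s q^-1)); up to a scalar, raise s v
    is the image of T2 v under the second factor. *)
Lemma raise_defect s v : s != 0 -> I v = weight s *: v ->
  raise s v = - 'i *: (I (T2 v) - weight (s / p ^+ 2) *: T2 v).
Proof.
move=> s0 Iv; rewrite IT2 Iv linearZ /= /raise /weight.
compare_coefficients [:: T2 v; T1 v]; field: (sqrCi C); rewrite ?s0 ?p0 ?qq0 //.
Qed.

(** The Casimir element, obtained by expanding lower (s q) (raise s v) and
    eliminating s with the eigenvalue equation for v. *)
Definition casimir v :=
  p ^+ 2 *: T2 (T2 v) + p ^- 2 *: T1 (T1 v)
  - (p * (p ^+ 2 - p ^- 2)) *: T2 (T1 (I v)).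

Lemma casimir_linear : linear casimir.
Proof.
move=> k u v; rewrite /casimir !linearP /=.
by compare_coefficients [:: T2 (T2 u); T1 (T1 u); T2 (T1 (I u));
  T2 (T2 v); T1 (T1 v); T2 (T1 (I v))]; ring.
Qed.
HB.instance Definition _ := GRing.isLinear.Build C V V _ casimir casimir_linear.

Lemma lower_raise s v : s != 0 -> I v = weight s *: v ->
  lower (s * p ^+ 2) (raise s v) = casimir v.
Proof.
move=> s0 Iv; rewrite lowerE /raise /casimir !linearB !linearZ /= T1T2 Iv
  !linearZ /= /weight.
compare_coefficients [:: T2 (T2 v); T1 (T1 v); T2 (T1 v)];
  by field: (sqrCi C); rewrite ?s0 ?p0 ?qq0.
Qed.

Lemma raise_lower s v : s != 0 -> I v = weight s *: v ->
  raise (s / p ^+ 2) (lower s v) = casimir v.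
Proof.
move=> s0 Iv; rewrite -(@lower_raise (- s^-1)) ?oppr_eq0 ?invr_eq0 ?weight_dual
  //.
by rewrite /lower linearN mulNr invrN opprK /= (invfM s^-1) invrK.
Qed.

Let linE := (linearD I, linearN I, linearZ_LR I, linearD T1, linearN T1,
  linearZ_LR T1, linearD T2, linearN T2, linearZ_LR T2).

Lemma casimirI v : I (casimir v) = casimir (I v).
Proof.
rewrite /casimir !(linE, IT1, IT2, T1T2).
compare_coefficients [:: T2 (T2 (I v)); T1 (T1 (I v)); T2 (T1 (I (I v)));
  T2 (T1 v)];
  by field; rewrite ?p0.
Qed.

Lemma casimirT2 v : T2 (casimir v) = casimir (T2 v).
Proof.
rewrite /casimir !(linE, IT1, IT2, T1T2).
compare_coefficients [:: T2 (T2 (T2 v)); T2 (T1 (T1 v)); T2 (T2 (T1 (I v)))];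
  by field; rewrite ?p0.
Qed.

Lemma lower_T2 s v : lower (s * p ^+ 2) (T2 v) = p ^+ 2 *: T2 (lower s v).
Proof.
rewrite !lowerE !linE T1T2.
by compare_coefficients [:: T2 (T2 v); T2 (T1 v)]; field; rewrite p0.
Qed.

Hypothesis spanI : forall v, lin [set w | exists l, I w = l *: w] v.
Hypothesis simple : forall W : set V, linear_subspace W ->
  (forall v, W v -> W (I v)) -> (forall v, W v -> W (T2 v)) ->
  forall v, W v -> v != 0 -> forall w, W w.
Hypothesis finI : forall l, finite_dimensional [set v | I v = l *: v].
Hypothesis nonzero : exists v : V, v != 0.

Lemma eigenvector_exists : exists l v, v != 0 /\ I v = l *: v.
Proof.
have [x x0] := nonzero; apply: contrapT => none.
suff : [set 0] x by move=> /= xE; rewrite xE eqxx in x0.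
have s0 : linear_subspace ([set 0] : set V).
  by split=> // k u v /= -> ->; rewrite scaler0 addr0.
apply: (lin_least s0) (spanI x) => w [l Iw] /=.
by apply/eqP; apply: contrapT => w0; apply: none; exists l, w; split=> //;
  apply/negP.
Qed.

(** Schur's lemma: the eigenspaces of the central element are invariant, and
    one of them is nonzero since it preserves a finite-dimensional eigenspace
    of I. *)
Lemma casimir_scalar : exists c, forall v, casimir v = c *: v.
Proof.
have [l [v [v0 Iv]]] := eigenvector_exists.
pose E := [set w | I w = l *: w].
have sE : linear_subspace E.
  split=> [|k u w Eu Ew]; rewrite /E /= ?linear0 ?scaler0 //.
  by rewrite linearP /= Eu Ew scalerDr !scalerA mulrC.
have [|c [w [_ w0 cw]]] :=
  @fin_dim_eigenvector _ _ casimir E v sE (finI l) _ Iv v0.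
  by move=> w Ew; rewrite /E /= casimirI Ew linearZ.
exists c; apply: (@simple [set u | casimir u = c *: u]) cw w0.
- split=> [|k u x Eu Ex]; rewrite /= ?linear0 ?scaler0 //.
  by rewrite linearP /= Eu Ex scalerDr !scalerA mulrC.
- by move=> u /= cu; rewrite -casimirI cu linearZ.
- by move=> u /= cu; rewrite -casimirT2 cu linearZ.
Qed.

Definition one_dim := exists2 v : V, v != 0 & forall w, exists k, w = k *: v.

(** T1 is a combination of I T2 and T2 I, so it kills v as well. *)
Lemma T2_kill_one_dim l v : v != 0 -> I v = l *: v -> T2 v = 0 -> one_dim.
Proof.
move=> v0 Iv T2v; exists v => // w.
have sv : linear_subspace [set w | exists k, w = k *: v].
  split=> [|k _ _ [a ->] [b ->]]; first by exists 0; rewrite scale0r.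
  by exists (k * a + b); rewrite scalerA scalerDl.
apply: (simple sv) v0 w; last by exists 1; rewrite scale1r.
  by move=> _ [k ->]; exists (k * l); rewrite linearZ /= Iv scalerA.
by move=> _ [k ->]; exists 0; rewrite linearZ /= T2v scaler0 scale0r.
Qed.

Lemma kill_one_dim s v : s + s^-1 != 0 -> v != 0 -> I v = weight s *: v ->
  raise s v = 0 -> lower s v = 0 -> one_dim.
Proof.
move=> d0 v0 Iv rv lv; apply: (T2_kill_one_dim v0 Iv).
by apply: (scalerI d0); rewrite T2_raise_lower rv lv addr0 scaler0.
Qed.

(** The factor r^-1 normalizes the vectors so that raising and lowering both
    multiply by r when the Casimir element acts by r^2. *)
Fixpoint chain s r v n :=
  if n is n'.+1 then r^-1 *: raise (s * q ^+ n') (chain s r v n') else v.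

Let q0 : q != 0. Proof. by rewrite expf_neq0. Qed.

Let sqn0 s n : s != 0 -> s * q ^+ n != 0.
Proof. by move=> s0; rewrite mulf_neq0 ?expf_neq0. Qed.

Let sum_inv_neq0 x : x != 0 -> x ^+ 2 != -1 -> x + x^-1 != 0.
Proof.
move=> x0; apply: contraNneq => dx.
have : x * (x + x^-1) = 0 by rewrite dx mulr0.
by rewrite mulrDr divff // -expr2 => /eqP; rewrite addr_eq0.
Qed.

Lemma chain_eig s r v n : s != 0 -> I v = weight s *: v ->
  I (chain s r v n) = weight (s * q ^+ n) *: chain s r v n.
Proof.
move=> s0 Iv; elim: n => [|n IH] /=; first by rewrite expr0 mulr1.
rewrite linearZ /= raise_eig ?sqn0 // !scalerA mulrC; congr (weight _ * _ *: _).
by rewrite (exprSr q) mulrA.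
Qed.

Lemma lower_chain s r c v n : s != 0 -> I v = weight s *: v ->
  (forall u, casimir u = c *: u) ->
  lower (s * q ^+ n.+1) (chain s r v n.+1) = (r^-1 * c) *: chain s r v n.
Proof.
move=> s0 Iv cas; rewrite /= linearZ /= (exprSr q) mulrA.
by rewrite lower_raise ?sqn0 ?chain_eig // cas scalerA.
Qed.

(** This excludes both w(s q^k) = w(s), for k >= 1, and the vanishing of
    x + x^-1 at x = s q^k, which happens when s^2 q^(2 k) = -1. *)
Definition upward_generic s := forall k, (0 < k)%N -> s ^+ 2 * q ^+ k != -1.

Let qS_eq1 n : q ^+ n.+1 = 1 -> False.
Proof. by move/eqP; apply/negP/q_not_root. Qed.

(** ** The Casimir element acts by zero *)
Section ZeroCasimir.
Hypothesis cas0 : forall v, casimir v = 0.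

(** If raise s v were nonzero, the vectors obtained by raising v at least once
    would span the whole space by irreducibility; but I has no eigenvector for
    w(s) in their span. *)
Lemma raise_eq0 s v : s != 0 -> upward_generic s -> I v = weight s *: v ->
  raise s v = 0.
Proof.
move=> s0 gs Iv; apply/eqP/negPn/negP => rv0.
pose u k := chain s 1 v k.+1.
have u0 : u 0%N = raise s v by rewrite /u /= invr1 scale1r expr0 mulr1.
have Iu k : I (u k) = weight (s * q ^+ k.+1) *: u k by apply: chain_eig.
have sL := lin_subspace (range u).
have inL k : lin (range u) (u k) by apply: sub_lin; exists k.
have Lv : lin (range u) v.
  apply: (simple sL _ _ (inL 0%N)); last by rewrite u0.
    apply: (lin_image sL) => _ [k _ <-]; rewrite Iu; exact: subspaceZ.
  apply: (lin_image sL) => _ [k _ <-].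
  have d0 : s * q ^+ k.+1 + (s * q ^+ k.+1)^-1 != 0.
    apply: sum_inv_neq0; first exact: sqn0.
    by rewrite exprMn -exprM gs // muln_gt0.
  rewrite -[T2 _]scale1r -(mulVf d0) -scalerA T2_raise_lower.
  rewrite (@lower_chain s 1 0) //; last by move=> w; rewrite cas0 scale0r.
  rewrite mulr0 scale0r addr0.
  have -> : raise (s * q ^+ k.+1) (u k) = u k.+1.
    by rewrite /u /= invr1 !scale1r.
  exact: subspaceZ.
have v0 : v = 0.
  apply: (@eig_sep _ _ I (weight s)) => //; apply: lin_least Lv;
    first exact: lin_subspace.
  move=> _ [k _ <-]; apply: sub_lin; exists (weight (s * q ^+ k.+1)) => //.
  apply/eqP => /(weight_eq (sqn0 _ s0) s0)[/eqP|/eqP].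
    by rewrite -[X in _ == X]mulr1 (inj_eq (mulfI s0)) (negPf (q_not_root _)).
  by rewrite mulrAC -expr2 (negPf (gs _ _)).
by move: rv0; rewrite v0 linear0 eqxx.
Qed.

(** Lowering turns s^2 = - q^(n + 2) into s^2 = - q^n.
    For n = 0, lower s is - raise s, hence zero on v, and T2 v, an eigenvector
    for w(s q^-1) = w(s q), is killed by raise and lower unless it is zero.
    For n = 1, lower s preserves the eigenspace of w(s) and has square zero
    there. *)
Lemma one_dim_degenerate n s v : s ^+ 2 = - q ^+ n -> v != 0 ->
  I v = weight s *: v -> one_dim.
Proof.
elim/ltn_ind: n s v => n IH s v s2 v0 Iv.
have s0 : s != 0.
  by apply: contra_eq_neq s2 => ->; rewrite expr0n /= eq_sym oppr_eq0 expf_neq0.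
have gs : upward_generic s.
  move=> [//|k] _; rewrite s2 mulNr eqr_opp -exprD addnS; apply/eqP;
    exact: qS_eq1.
have rv := raise_eq0 s0 gs Iv.
have [s2N|d0] := eqVneq (s ^+ 2) (-1).
  have sV : s^-1 = - s.
    by apply: (mulfI s0); rewrite divff // mulrN -expr2 s2N opprK.
  have lv : lower s v = 0 by rewrite /lower sV opprK rv oppr0.
  have [T2v|T2v] := eqVneq (T2 v) 0; first exact: (T2_kill_one_dim v0 Iv T2v).
  have ITv : I (T2 v) = weight (s * q) *: T2 v.
    rewrite -[in RHS]weight_dual invfM sV mulNr opprK.
    apply/eqP; rewrite -subr_eq0; apply/eqP/(scalerI (_ : - 'i != 0)).
      by rewrite oppr_eq0 neq0Ci.
    by rewrite -raise_defect // rv scaler0.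
  apply: (kill_one_dim _ T2v ITv).
  - apply: sum_inv_neq0; first by rewrite mulf_neq0.
    by rewrite exprMn s2N mulN1r eqr_opp q_not_root.
  - apply: raise_eq0 ITv; first by rewrite mulf_neq0.
    move=> [//|k] _; rewrite exprMn s2N mulN1r mulNr eqr_opp -exprD.
    exact: q_not_root.
  - by rewrite lower_T2 lv linear0 scaler0.
have {}d0 := sum_inv_neq0 s0 d0.
have [lv|lv] := eqVneq (lower s v) 0;
  first exact: (kill_one_dim d0 v0 Iv rv lv).
have Il := lower_eig s0 Iv.
case: n s2 IH => [|[|n]] s2 IH.
- by move: d0; rewrite -[s^-1]mulr1 -[1]opprK -[1](expr0 q) -s2 mulrN mulKf //
    subrr eqxx.
- have sq : s / p ^+ 2 = - s^-1.
    by apply: (mulfI s0); rewrite mulrA -expr2 s2 expr1 mulNr mulrN !divff.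
  rewrite sq weight_dual in Il.
  apply: (kill_one_dim d0 lv Il); first exact: raise_eq0.
  by rewrite {1}/lower -sq raise_lower // cas0 oppr0.
- apply: (IH n _ (s / q) _ _ lv Il) => //.
  by rewrite expr_div_n s2 mulNr -addn2 exprD mulfK // expf_neq0.
Qed.

(** If s is not upward generic, then s^2 = - q^-k and -s^-1 has square
    - q^k. *)
Lemma one_dim_of_casimir0 : one_dim.
Proof.
have [l [v [v0 Iv]]] := eigenvector_exists.
have [s s0 sl] := weight_surj l; rewrite -sl in Iv => {l sl}.
have sV0 : - s^-1 != 0 by rewrite oppr_eq0 invr_eq0.
have IvV : I v = weight (- s^-1) *: v by rewrite weight_dual.
have [[k sk]|ns] := EM (exists k, s ^+ 2 * q ^+ k = -1).
  apply: (one_dim_degenerate (n := k) _ v0 IvV).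
  rewrite sqrrN exprVn; apply: (mulfI (expf_neq0 2 s0)).
  by rewrite divff ?expf_neq0 // mulrN sk opprK.
have [[k sk]|nsV] := EM (exists k, s ^+ 2 = - q ^+ k).
  exact: (one_dim_degenerate sk v0 Iv).
have gs : upward_generic s by move=> k _; apply/eqP => sk; apply: ns; exists k.
have gsV : upward_generic (- s^-1).
  move=> k _; apply/eqP => sk; apply: nsV; exists k.
  apply: oppr_inj; rewrite opprK; apply: (mulfI (expf_neq0 2 sV0)).
  by rewrite sk mulrN sqrrN -exprMn mulVf // expr1n.
apply: (kill_one_dim _ v0 Iv); last 2 first.
- exact: raise_eq0.
- by rewrite /lower raise_eq0 ?oppr0.
apply: sum_inv_neq0 => //; apply/eqP => s2; apply: ns; exists 0%N.
by rewrite expr0 mulr1.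
Qed.

End ZeroCasimir.

(** ** The Casimir element acts by a nonzero scalar *)
Section NonzeroCasimir.
Variable r : C.
Hypothesis r0 : r != 0.
Hypothesis cas : forall v, casimir v = r ^+ 2 *: v.

Lemma raise_neq0 s v : s != 0 -> v != 0 -> I v = weight s *: v ->
  raise s v != 0.
Proof.
move=> s0 v0 Iv; apply/eqP => rv; have := cas v.
rewrite -(lower_raise s0 Iv) rv linear0 => /esym/eqP.
by rewrite scaler_eq0 expf_eq0 (negPf r0) (negPf v0).
Qed.

(** Here s q and s q^-1 have the same weight mu, and raise s v is a multiple
    of (I - mu) T2 v that is itself an eigenvector for mu; since I is
    diagonalizable, it vanishes. *)
Lemma sqr_neqN1 s v : s != 0 -> v != 0 -> I v = weight s *: v -> s ^+ 2 != -1.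
Proof.
move=> s0 v0 Iv; apply/eqP => s2.
have sV : s^-1 = - s by apply: (mulfI s0);
  rewrite divff // mulrN -expr2 s2 opprK.
have weightE : weight (s * p ^+ 2) = weight (s / p ^+ 2).
  by rewrite -[LHS]weight_dual invfM sV mulNr opprK.
have := raise_eig s0 Iv; rewrite (raise_defect s0 Iv) weightE.
set w := I (T2 v) - _ => Iw.
have iN0 : - 'i != 0 :> C by rewrite oppr_eq0 neq0Ci.
have /(scalerI iN0)/eig_semisimple E :
    - 'i *: I w = - 'i *: (weight (s / p ^+ 2) *: w).
  by rewrite -linearZ /= Iw !scalerA mulrC.
have := raise_neq0 s0 v0 Iv;
  rewrite (raise_defect s0 Iv) E ?subrr ?scaler0 ?eqxx //.
Qed.

Lemma chain_neq0 s t v n : s != 0 -> t != 0 -> v != 0 -> I v = weight s *: v ->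
  chain s t v n != 0.
Proof.
move=> s0 t0 v0 Iv; elim: n => //= n IH.
rewrite scaler_eq0 invr_eq0 (negPf t0) /=.
by apply: raise_neq0 => //; [exact: sqn0|exact: chain_eig].
Qed.

Lemma raise_chain s t v n : t != 0 ->
  raise (s * q ^+ n) (chain s t v n) = t *: chain s t v n.+1.
Proof. by move=> t0; rewrite /= scalerA divff // scale1r. Qed.

Lemma lower_chainE s t v n : s != 0 -> t ^+ 2 = r ^+ 2 -> I v = weight s *: v ->
  lower (s * q ^+ n.+1) (chain s t v n.+1) = t *: chain s t v n.
Proof.
move=> s0 t2 Iv; rewrite (lower_chain _ _ s0 Iv cas) -t2 expr2 mulKf //.
by rewrite -sqrf_eq0 t2 sqrf_eq0.
Qed.

(** Lowering v is raising it for the parameter -s^-1, up to the sign that is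
    absorbed by replacing r with -r. *)
Definition zchain s v (m : int) :=
  match m with
  | Posz n => chain s r v n
  | Negz n => chain (- s^-1) (- r) v n.+1
  end.

Section IntegerChain.
Variables (s : C) (v : V).
Hypotheses (s0 : s != 0) (v0 : v != 0) (Iv : I v = weight s *: v).

Let sV0 : - s^-1 != 0. Proof. by rewrite oppr_eq0 invr_eq0. Qed.
Let IvV : I v = weight (- s^-1) *: v. Proof. by rewrite weight_dual. Qed.
Let rN0 : - r != 0. Proof. by rewrite oppr_eq0. Qed.

Let dualq n : - (- s^-1 * q ^+ n)^-1 = s * q ^ (- n%:Z).
Proof. by rewrite mulNr invrN opprK invfM invrK -exprnN. Qed.

Lemma zchainN n : zchain s v (- n%:Z) = chain (- s^-1) (- r) v n.
Proof. by case: n. Qed.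

Lemma zchain_neq0 m : zchain s v m != 0.
Proof. by case: m => n; apply: chain_neq0. Qed.

Lemma zchain_eig m : I (zchain s v m) = weight (s * q ^ m) *: zchain s v m.
Proof.
case: (intP m) => [|n|n]; first by rewrite /= expr0z mulr1.
  exact: chain_eig.
by rewrite zchainN (chain_eig _ _ sV0 IvV) -[in LHS]weight_dual dualq.
Qed.

Lemma raise_zchain m :
  raise (s * q ^ m) (zchain s v m) = r *: zchain s v (m + 1).
Proof.
case: (intP m) => [|n|n].
- exact: (raise_chain _ _ 0).
- have -> : n.+1%:Z + 1 = n.+2%:Z by rewrite -PoszD addn1.
  exact: raise_chain.
have -> : - n.+1%:Z + 1 = - n%:Z by rewrite -addn1 PoszD opprD addrNK.
rewrite !zchainN -dualq -[raise _ _]opprK -/(lower _ _).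
by rewrite lower_chainE ?sqrrN // scaleNr opprK.
Qed.

Lemma lower_zchain m :
  lower (s * q ^ m) (zchain s v m) = r *: zchain s v (m - 1).
Proof.
have le0 n : lower (s * q ^ (- n%:Z)) (zchain s v (- n%:Z)) =
    r *: zchain s v (- n%:Z - 1).
  have -> : - n%:Z - 1 = - n.+1%:Z by rewrite -opprD -PoszD addn1.
  rewrite !zchainN -dualq /lower invrN invrK opprK raise_chain //.
  by rewrite scaleNr opprK.
case: (intP m) => [|n|n]; [exact: (le0 0%N)| |exact: le0].
have -> : n.+1%:Z - 1 = n%:Z by rewrite -addn1 PoszD addrK.
exact: lower_chainE.
Qed.

End IntegerChain.

Lemma T2_formula x u v w : x + x^-1 != 0 ->
  raise x u = r *: v -> lower x u = r *: w ->
  T2 u = (r / (x + x^-1)) *: (v + w).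
Proof.
move=> d0 ru lu; apply: (scalerI d0).
by rewrite T2_raise_lower ru lu -scalerDr scalerA mulrC divfK.
Qed.

Lemma T1_formula x u v w : x != 0 -> x + x^-1 != 0 ->
  raise x u = r *: v -> lower x u = r *: w ->
  T1 u = ('i * p * r / (x + x^-1)) *: (x *: v - x^-1 *: w).
Proof.
move=> x0 d0 ru lu; apply: (scalerI d0); rewrite T1_raise_lower // ru lu.
have d0' : x * x + 1 != 0 by rewrite -(divff x0) -mulrDr mulf_neq0.
by compare_coefficients [:: v; w]; field; rewrite x0.
Qed.

Lemma span_eq (J : Type) (v : J -> V) (j0 : J) :
  v j0 != 0 -> (forall j, exists l, I (v j) = l *: v j) ->
  (forall j, lin (range v) (T2 (v j))) -> forall w, lin (range v) w.
Proof.
move=> v0 Iv T2v; have sL := lin_subspace (range v).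
apply: (simple sL _ _ _ v0); last by apply: sub_lin; exists j0.
  apply: (lin_image sL) => _ [j _ <-]; have [l ->] := Iv j.
  by apply: subspaceZ => //; apply: sub_lin; exists j.
by apply: (lin_image sL) => _ [j _ <-].
Qed.

Definition Rrs_vectors s (v : int -> V) :=
  [/\ forall P, lcomb (v \o int_of_nat) P = 0 -> P = 0,
      forall w, lin (range v) w &
    forall m,
    [/\ I (v m) = ('i * ((s * q ^ m - s^-1 * q ^ (- m)) / (q - q^-1))) *: v m,
        T2 (v m) = (r / (s * q ^ m + s^-1 * q ^ (- m))) *:
          (v (m + 1) + v (m - 1)) &
        T1 (v m) = ('i * p * r / (s * q ^ m + s^-1 * q ^ (- m))) *:
          ((s * q ^ m) *: v (m + 1) - (s^-1 * q ^ (- m)) *: v (m - 1))]].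

Definition Rr_vectors eps (v : nat -> V) :=
  [/\ forall P, lcomb v P = 0 -> P = 0, forall w, lin (range v) w,
    forall j, I (v j) =
      (- eps * ((q ^+ j * p + q ^- j * p^-1) / (q - q^-1))) *: v j,
    T2 (v 0%N) = (- eps * (r / (p - p^-1))) *: (v 0%N + 'i *: v 1%N) /\
    (forall j, T2 (v j.+1) =
      (- eps * ('i * r / (q ^+ j.+1 * p - q ^- j.+1 * p^-1))) *:
        (v j.+2 + v j)) &
    T1 (v 0%N) = (r / (p - p^-1)) *: (v 0%N + ('i * q) *: v 1%N) /\
    (forall j, T1 (v j.+1) =
      ('i * r / (q ^+ j.+1 * p - q ^- j.+1 * p^-1)) *:
        (q ^+ j.+2 *: v j.+2 + q ^- j.+1 *: v j))].

Lemma zchain_Rrs s v : s != 0 -> (forall m : int, s ^+ 2 * q ^ m != -1) ->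
  v != 0 -> I v = weight s *: v -> Rrs_vectors s (zchain s v).
Proof.
move=> s0 s2 v0 Iv; have x0 m : s * q ^ m != 0 by rewrite mulf_neq0 ?expfz_neq0.
have d0 m : s * q ^ m + (s * q ^ m)^-1 != 0.
  by apply: sum_inv_neq0 => //; rewrite exprMn (exprnP (q ^ m)) exprz_exp s2.
have T2z m := T2_formula (d0 m) (raise_zchain s0 Iv m) (lower_zchain s0 Iv m).
have xV m : s^-1 * q ^ (- m) = (s * q ^ m)^-1 by rewrite invfM invr_expz.
split=> [P||m].
- pose l := (fun m => weight (s * q ^ m)) \o int_of_nat.
  apply: (eig_free (f := I) (l := l)) => [|i|i].
  + exact: inj_comp (weight_inj s0 s2) (can_inj int_of_natK).
  + exact: zchain_eig.
  + exact: zchain_neq0.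
- apply: (@span_eq _ _ 0) => [|m|m]; first exact: zchain_neq0.
    by exists (weight (s * q ^ m)); exact: zchain_eig.
  rewrite T2z; have sL := lin_subspace (range (zchain s v)).
  by apply: subspaceZ => //; apply: subspaceD => //; apply: sub_lin; eexists.
rewrite xV; split; [exact: zchain_eig|exact: T2z|].
exact: (T1_formula (x0 m) (d0 m) (raise_zchain s0 Iv m) (lower_zchain s0 Iv m)).
Qed.

(** Here t q^-1 = -t^-1 has the same weight as t, so lower t is an operator L
    on the eigenspace, and L^2 = - r^2 because raise (t q^-1) = - L.  Then
    (L + i r) (L - i r) = 0 makes L v - i r v an eigenvector, unless it is
    zero and v is one. *)
Lemma lower_eigenvector t v : t ^+ 2 = - q -> v != 0 -> I v = weight t *: v ->
  exists a w, [/\ a ^+ 2 = r ^+ 2, w != 0, I w = weight t *: w &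
    lower t w = (- 'i * a) *: w].
Proof.
move=> t2 v0 Iv.
have t0 : t != 0 by rewrite -sqrf_eq0 t2 oppr_eq0.
have tq : t / p ^+ 2 = - t^-1.
  by apply: (mulfI t0); rewrite mulrA -expr2 t2 mulNr mulrN !divff.
have Il u : I u = weight t *: u -> I (lower t u) = weight t *: lower t u.
  by move=> Iu; rewrite (lower_eig t0 Iu) tq weight_dual.
have ll u : I u = weight t *: u -> lower t (lower t u) = - r ^+ 2 *: u.
  by move=> Iu; rewrite {1}/lower -tq raise_lower // cas scaleNr.
have [lv|lv] := eqVneq (lower t v) (('i * r) *: v).
  by exists (- r), v; rewrite sqrrN mulrNN.
exists r, (lower t v - ('i * r) *: v); split=> //.
- by rewrite subr_eq0.
- by rewrite linearB linearZ /= Il // Iv scalerBr !scalerA [weight t * _]mulrC.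
- rewrite linearB linearZ /= ll //.
  compare_coefficients [:: v; lower t v]; first by ring: (sqrCi C).
  by ring.
Qed.

End NonzeroCasimir.

(** The sign eps in t = eps i p accounts for the two square roots of - q.  The
    other sign in the formulas of R_r can be taken to be 1 because r is only
    determined up to sign by the Casimir element: here lower t v = - i r v
    fixes it. *)
Lemma chain_Rr r eps v : r != 0 -> (forall u, casimir u = r ^+ 2 *: u) ->
  eps ^+ 2 = 1 -> let t := eps * ('i * p) in
  v != 0 -> I v = weight t *: v -> lower t v = (- 'i * r) *: v ->
  Rr_vectors r eps (chain t r v).
Proof.
move=> r0 cas eps2 t v0 Iv lv.
have eps0 : eps != 0 by rewrite -sqrf_eq0 eps2 oner_eq0.
have t2 : t ^+ 2 = - q by rewrite !exprMn eps2 mul1r sqrCi mulN1r.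
have t0 : t != 0 by rewrite -sqrf_eq0 t2 oppr_eq0.
have x0 j : t * q ^+ j != 0 by rewrite mulf_neq0 ?expf_neq0.
have d0 j : t * q ^+ j + (t * q ^+ j)^-1 != 0.
  apply: sum_inv_neq0 => //.
  rewrite exprMn t2 -exprM mulNr eqr_opp -exprS; exact: q_not_root.
have xV j : (t * q ^+ j)^-1 = - (eps * 'i) * (q ^- j * p^-1).
  apply: (mulfI (x0 j)); rewrite divff //.
  have Q0 : q ^+ j != 0 by rewrite expf_neq0.
  by rewrite /t; move: (q ^+ j) Q0 => Q Q0; field: eps2 (sqrCi C);
    rewrite p0 Q0.
have xE j : t * q ^+ j = (eps * 'i) * (q ^+ j * p) by rewrite /t; ring.
have dE j : t * q ^+ j + (t * q ^+ j)^-1 =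
    (eps * 'i) * (q ^+ j * p - q ^- j * p^-1).
  by rewrite xV xE mulrBr mulNr.
have D0 j : q ^+ j * p - q ^- j * p^-1 != 0.
  by have := d0 j; rewrite dE !mulf_eq0 !negb_or => /andP[].
have Ic j : I (chain t r v j) = weight (t * q ^+ j) *: chain t r v j.
  exact: chain_eig.
have rv j : raise (t * q ^+ j) (chain t r v j) = r *: chain t r v j.+1.
  exact: raise_chain.
have {}lv : lower (t * q ^+ 0) (chain t r v 0) = r *: (- 'i *: v).
  by rewrite expr0 mulr1 lv scalerA mulrC.
have lS j : lower (t * q ^+ j.+1) (chain t r v j.+1) = r *: chain t r v j.
  exact: (lower_chainE r0).
have kE k j : k / (t * q ^+ j + (t * q ^+ j)^-1) =
    - eps * ('i * k / (q ^+ j * p - q ^- j * p^-1)).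
  rewrite dE; move: (_ - _) (D0 j) => D DN0; field: eps2 (sqrCi C).
  by rewrite DN0 eps0 neq0Ci.
have T2v := T2_formula (d0 0%N) (rv 0%N) lv.
have T2S j := T2_formula (d0 j.+1) (rv j.+1) (lS j).
have T1v := T1_formula (x0 0%N) (d0 0%N) (rv 0%N) lv.
have T1S j := T1_formula (x0 j.+1) (d0 j.+1) (rv j.+1) (lS j).
split.
- apply: (eig_free (weight_inj_nat t2) Ic) => j.
  exact: (chain_neq0 r0 cas).
- have sL := lin_subspace (range (chain t r v)).
  have inL j : lin (range (chain t r v)) (chain t r v j) by apply: sub_lin;
    exists j.
  apply: (@span_eq _ _ 0%N) => [//|j|[|j]].
  + by exists (weight (t * q ^+ j)).
  + rewrite T2v; apply: subspaceZ => //; apply: subspaceD => //.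
    exact: (subspaceZ _ sL (inL 0%N)).
  + by rewrite T2S; apply: subspaceZ => //; apply: subspaceD.
- move=> j; rewrite Ic /weight xV xE; congr (_ *: _).
  by rewrite /q; ring: (sqrCi C).
- split=> [|j]; last by rewrite T2S kE.
  rewrite T2v kE expr0 invr1 !mul1r.
  by compare_coefficients [:: chain t r v 1; v]; ring: (sqrCi C).
- split=> [|j]; last first.
    rewrite T1S kE xV xE (exprS q j.+1 : _ = p ^+ 2 * _).
    compare_coefficients [:: chain t r v j.+2; chain t r v j];
      move: (_ - _)^-1 => D.
      by move: (q ^+ j.+1) => Q; ring: (sqrCi C) eps2.
    by move: (q ^- j.+1) => Q; field: (sqrCi C) eps2; rewrite p0.
  rewrite T1v kE xV xE expr0 invr1 !mul1r.
  have D0' : p - p^-1 != 0 by have := D0 0%N; rewrite expr0 invr1 !mul1r.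
  compare_coefficients [:: chain t r v 1; v].
    by rewrite /q; move: (p - p^-1)^-1 => D; ring: (sqrCi C) eps2.
  move: (p - p^-1)^-1 => D; field: (sqrCi C) eps2; exact: p0.
Qed.

Theorem classification :
  [\/ exists r s v, [/\ r != 0, s != 0, forall m : int, s ^+ 2 * q ^ m != -1 &
        Rrs_vectors r s v],
      exists r eps v, [/\ r != 0, eps = 1 \/ eps = -1 & Rr_vectors r eps v] |
      one_dim].
Proof.
have [c cas] := casimir_scalar.
have [c0|c0] := eqVneq c 0.
  by apply: Or33; apply: one_dim_of_casimir0 => v; rewrite cas c0 scale0r.
pose r := sqrtC c; have r2 : r ^+ 2 = c by rewrite sqrtCK.
have r0 : r != 0 by rewrite sqrtC_eq0.
rewrite -r2 in cas.
have [l [v [v0 Iv]]] := eigenvector_exists.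
have [s s0 sl] := weight_surj l; rewrite -sl in Iv => {l sl}.
have [[m /eqP sm]|ns] := EM (exists m : int, s ^+ 2 * q ^ m == -1); last first.
  apply: Or31; exists r, s, (zchain r s v); split=> // [m|].
    by apply/negP => sm; apply: ns; exists m.
  apply: zchain_Rrs => // m; apply/negP => sm; apply: ns; by exists m.
(* (s q^j)^2 = - q^(2 j - m) is -1 if m is even and - q if m is odd. *)
pose j := ((m + 1) %/ 2)%Z.
have z0 k : s * q ^ k != 0 by rewrite mulf_neq0 ?expfz_neq0.
have z2 k : (s * q ^ k) ^+ 2 = - q ^ (k * 2 - m).
  rewrite exprMn (exprnP (q ^ k)) exprz_exp expfzDr // -invr_expz mulrC -mulrN.
  apply: (mulIf (expfz_neq0 m q0)).
  by rewrite -(mulrA _ (s ^+ 2)) sm -(mulrA _ (- _)) mulNr mulVf ?expfz_neq0.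
have zn k := zchain_neq0 r0 cas s0 v0 Iv k.
have zI k := zchain_eig r s0 Iv k.
have jE := divz_eq (m + 1) 2.
have : ((m + 1) %% 2)%Z = 0 \/ ((m + 1) %% 2)%Z = 1.
  have := @ltz_pmod (m + 1) 2 isT.
  have := @modz_ge0 (m + 1) 2 isT.
  by case: (_ %% _)%Z => // -[|[|]] //; [left|right].
case=> mE; last first.
  exfalso; have := sqr_neqN1 r0 cas (z0 j) (zn j) (zI j); rewrite z2.
  have -> : j * 2 - m = 0 by apply/eqP;
    rewrite subr_eq0 -(inj_eq (addIr 1)) jE mE.
  by rewrite expr0z eqxx.
have t2 : (s * q ^ j) ^+ 2 = - q.
  rewrite z2; have -> : j * 2 - m = 1 by rewrite -[j * 2]addr0 -mE -jE addrAC
    subrr add0r.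
  by rewrite expr1z.
have [a [w [a2 w0 Iw lw]]] := lower_eigenvector cas t2 (zn j) (zI j).
have a0 : a != 0 by rewrite -sqrf_eq0 a2 sqrf_eq0.
pose eps := s * q ^ j / ('i * p).
have ip0 : 'i * p != 0 by rewrite mulf_neq0 ?neq0Ci.
have tE : s * q ^ j = eps * ('i * p) by rewrite divfK.
have eps2 : eps ^+ 2 = 1.
  by rewrite expr_div_n t2 exprMn sqrCi mulN1r divff // oppr_eq0.
apply: Or32; exists a, eps, (chain (s * q ^ j) a w); split=> //.
  by have /eqP := eps2; rewrite sqrf_eq1 => /orP[]/eqP; [left|right].
by rewrite tE in Iw lw *; apply: chain_Rr => // u; rewrite a2.
Qed.

End Classification.

(** * Orthonormal bases *)
Section GramSchmidt.
Variables (C : numClosedFieldType) (U : lmodType C).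
Variables (form : {dot U for Num.conj}) (v : nat -> U).
Hypothesis free_v : forall P, lcomb v P = 0 -> P = 0.

Definition normalize (w : U) := (sqrtC (form w w))^-1 *: w.

Fixpoint gram_schmidt_seq n : seq U :=
  if n is n'.+1 then
    let s := gram_schmidt_seq n' in
    rcons s (normalize (v n' - \sum_(x <- s) form (v n') x *: x))
  else [::].

Definition gram_schmidt n := last 0 (gram_schmidt_seq n.+1).

Let residual n := v n - \sum_(k < n)
  form (v n) (gram_schmidt k) *: gram_schmidt k.

Lemma gram_schmidtE n : gram_schmidt n = normalize (residual n).
Proof.
have seqE m : gram_schmidt_seq m = [seq gram_schmidt k | k <- iota 0 m].
  elim: m => // m IH; rewrite -addn1 iotaD map_cat -IH addn1 cats1 /=.
  by rewrite /gram_schmidt /= last_rcons.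
rewrite {1}/gram_schmidt /= last_rcons seqE big_map /residual.
by rewrite -(big_mkord xpredT (fun k =>
  form (v n) (gram_schmidt k) *: gram_schmidt k)) /index_iota subn0.
Qed.

Let W n := [set lcomb v P | P in [set P : {poly C} | (size P <= n)%N]].

Let sW n : linear_subspace (W n).
Proof.
split=> [|k _ _ [P /= sP <-] [Q /= sQ <-]].
  by exists 0; rewrite /= ?size_poly0 ?linear0.
exists (k *: P + Q); rewrite /= ?linearP //.
rewrite (leq_trans (size_polyD _ _)) // geq_max sQ andbT.
exact: leq_trans (size_scale_leq _ _) sP.
Qed.

Let W_le m n : (m <= n)%N -> W m `<=` W n.
Proof. by move=> mn _ [P /= sP <-]; exists P => //=;
  exact: leq_trans sP mn. Qed.

Let vW n : W n.+1 (v n).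
Proof. by exists 'X^n; rewrite /= ?size_polyXn ?lcombXn. Qed.

Let vNW n : ~ W n (v n).
Proof.
move=> [P /= sP Pv]; have /free_v/eqP : lcomb v ('X^n - P) = 0.
  by rewrite linearB /= Pv lcombXn subrr.
by rewrite subr_eq0 => /eqP PX; rewrite -PX size_polyXn ltnn in sP.
Qed.

(** The n-th vector lies in the span of v 0, .., v n, so that freeness of v
    keeps all residuals nonzero. *)
Lemma gram_schmidt_sub n : W n.+1 (gram_schmidt n).
Proof.
elim/ltn_ind: n => n IH; rewrite gram_schmidtE; apply: subspaceZ => //.
apply: subspaceB => //; apply: subspace_sum => // k; apply: subspaceZ => //.
apply: (W_le _ (IH k (ltn_ord k))); exact: ltnW (ltn_ord k).
Qed.

Let residual_neq0 n : residual n != 0.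
Proof.
apply/eqP => /subr0_eq e; apply: (@vNW n); rewrite e.
apply: subspace_sum => // k; apply: subspaceZ => //.
exact: (W_le (ltn_ord k) (gram_schmidt_sub k)).
Qed.

Lemma gram_schmidt_orthonormal i j :
  form (gram_schmidt i) (gram_schmidt j) = (i == j)%:R.
Proof.
suff H n : forall i j, (i < n)%N -> (j < n)%N ->
    form (gram_schmidt i) (gram_schmidt j) = (i == j)%:R.
  by apply: (H (maxn i j).+1); rewrite ltnS ?leq_maxl ?leq_maxr.
elim: n => // n IH.
have orth k : (k < n)%N -> form (gram_schmidt n) (gram_schmidt k) = 0.
  move=> kn; rewrite gram_schmidtE linearZl_LR /=.
  suff -> : form (residual n) (gram_schmidt k) = 0 by rewrite mulr0.
  rewrite linearBl linear_sumlz (bigD1 (Ordinal kn)) //= linearZl_LR /= IH //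
    eqxx mulr1.
  rewrite big1 ?addr0 ?subrr // => l lk.
  have {lk} /negPf lk : l != k :> nat by [].
  by rewrite linearZl_LR /= IH // lk mulr0.
have norm1 : form (gram_schmidt n) (gram_schmidt n) = 1.
  rewrite gram_schmidtE dnormZ normfV ger0_norm ?sqrt_dnorm_ge0 //.
  by rewrite exprVn sqrtCK mulVf // dnorm_eq0 residual_neq0.
move=> {}i {}j; rewrite ltnS leq_eqVlt => /predU1P ni.
rewrite ltnS leq_eqVlt => /predU1P; case: ni => [->|lt_i] [->|lt_j].
- by rewrite eqxx.
- by rewrite orth // gtn_eqF.
- by rewrite hermC /= orth // rmorph0 mulr0 ltn_eqF.
- exact: IH.
Qed.

Lemma gram_schmidt_lin : lin (range gram_schmidt) = lin (range v).
Proof.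
have sL := lin_subspace (range gram_schmidt).
apply/seteqP; split; apply: lin_least => //; try exact: lin_subspace.
  by move=> _ [n _ <-]; rewrite -lcomb_range;
    case: (gram_schmidt_sub n) => P _ <-; exists P.
move=> _ [n _ <-].
have inL k : lin (range gram_schmidt) (gram_schmidt k) by apply: sub_lin;
  exists k.
rewrite -[v n](subrK (\sum_(k < n) form (v n) (gram_schmidt k) *: gram_schmidt
  k)).
apply: subspaceD => //; last by apply: subspace_sum => // k; exact: subspaceZ.
rewrite -/(residual n); set d := sqrtC (form (residual n) (residual n)).
have d0 : d != 0 by rewrite /d sqrtC_eq0 dnorm_eq0 residual_neq0.
have -> : residual n = d *: gram_schmidt n.
  by rewrite gram_schmidtE scalerA divff ?scale1r.
exact: subspaceZ.
Qed.

End GramSchmidt.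

Lemma orthonormal_lcomb_eq0 (C : numClosedFieldType) (U : lmodType C)
    (form : {dot U for Num.conj}) (e : nat -> U) :
  (forall i j, form (e i) (e j) = (i == j)%:R) ->
  forall P, lcomb e P = 0 -> P = 0.
Proof.
move=> oe P eP; apply/polyP => i; rewrite coef0.
have [lt_i|] := ltnP i (size P); last exact: nth_default.
have := congr1 (form^~ (e i)) eP; rewrite linear0l => e0; apply: etrans e0.
rewrite /lcomb linear_sumlz (bigD1 (Ordinal lt_i)) //= linearZl_LR /= oe eqxx
  /= mulr1.
rewrite big1 ?addr0 // => j /negPf ji.
by rewrite linearZl_LR /= oe -[_ == i]/(j == Ordinal lt_i) ji /= mulr0.
Qed.

Section BaseChange.
Variables (K : fieldType) (V : lmodType K).
Implicit Types (u v : nat -> V).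

Definition coords u (x : V) : {poly K} := xget 0 [set P | lcomb u P = x].
Definition base_change u v x := lcomb v (coords u x).

Lemma base_change_lcomb u v P : (forall Q, lcomb u Q = 0 -> Q = 0) ->
  base_change u v (lcomb u P) = lcomb v P.
Proof.
move=> free_u; rewrite /base_change /coords;
  case: xgetP => [Q _ /= QP|/(_ P)/(_ erefl)] //.
suff -> : Q = P by [].
by apply/eqP; rewrite -subr_eq0; apply/eqP/free_u; rewrite linearB /= QP subrr.
Qed.

End BaseChange.

Lemma eigenspaceI_subspace (R : realType) (p : R[i]) (H : hilbertType R)
    (pi : domain_rep p H) l : linear_subspace (eigenspaceI pi l).
Proof.
have sD := dom_subspace pi; split=> [|k x y [Dx Ix] [Dy Iy]].
  split; first exact: subspace0.
  have D0 := subspace0 sD.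
  have := op_linear (uq p gI) (-1) D0 D0.
  by rewrite scaler0 addr0 scaleN1r addNr => ->; rewrite scaler0.
split; first exact: (proj2 sD).
by rewrite op_linear // Ix Iy scalerDr !scalerA mulrC.
Qed.

(** * Transport of a representation along a bijection of its domain *)
Section Transport.
Variables (R : realType) (p : R[i]) (H : hilbertType R).
Variable pi : representation p H.
Hypothesis pi_irr : irreducible pi.
Variables (A B : H -> H).
Local Notation D := (dom pi).
Hypotheses (AD : forall x, D x -> D (A x)) (BD : forall x, D x -> D (B x)).
Hypothesis A_linear : forall (k : R[i]) x y, D x -> D y ->
  A (k *: x + y) = k *: A x + A y.
Hypothesis AK : forall x, D x -> B (A x) = x.
Hypothesis BK : forall x, D x -> A (B x) = x.

Let Dlin (k : R[i]) x y : D x -> D y -> D (k *: x + y).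
Proof. by case: (dom_subspace pi) => _; apply. Qed.

Let B_linear (k : R[i]) x y : D x -> D y -> B (k *: x + y) = k *: B x + B y.
Proof.
by move=> Dx Dy; rewrite -{1}(BK Dx) -{1}(BK Dy) -A_linear ?AK //; auto.
Qed.

Let A0 : A 0 = 0.
Proof.
have D0 := subspace0 (dom_subspace pi).
by have := A_linear (-1) D0 D0; rewrite scaler0 addr0 scaleN1r addNr.
Qed.

Definition transported_op a x := A (op pi a (B x)).

Let tA x y : D x -> D y -> A (x + y) = A x + A y.
Proof. by move=> Dx Dy; rewrite -[x]scale1r A_linear // !scale1r. Qed.

Let tZ (k : R[i]) x : D x -> A (k *: x) = k *: A x.
Proof.
move=> Dx; rewrite -[_ *: x]addr0 A_linear ?A0 ?addr0 //.
exact: subspace0 (dom_subspace pi).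
Qed.

Let opD a x : D x -> D (op pi a (B x)).
Proof. by move=> /BD; exact: op_dom. Qed.

Definition transported : domain_rep p H.
Proof.
refine (@DomainRep _ p H D transported_op (dom_subspace pi) (dom_dense pi)
  _ _ _ _ _ _).
- by move=> a x Dx; apply/AD/opD.
- by move=> a k x y Dx Dy; rewrite /transported_op B_linear //
    op_linear ?A_linear; auto.
- by move=> a b x Dx; rewrite /transported_op op_add ?tA; auto.
- by move=> k a x Dx; rewrite /transported_op op_scale ?tZ; auto.
- by move=> x Dx; rewrite /transported_op op_one ?BK; auto.
- by move=> a b x Dx; rewrite /transported_op AK ?op_mul; auto.
Defined.

Lemma transported_opA a x : D x -> op transported a (A x) = A (op pi a x).
Proof. by move=> Dx; rewrite /= /transported_op AK. Qed.

Lemma transported_eigenspace l x :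
  eigenspaceI pi l x -> eigenspaceI transported l (A x).
Proof.
move=> [Dx Ix]; split; first exact: AD.
by rewrite transported_opA // Ix tZ.
Qed.

Lemma transported_span : dom transported =
  lin [set x | x != 0 /\ exists l, eigenspaceI transported l x].
Proof.
set S' := [set _ | _]; have sD := dom_subspace pi.
apply/seteqP; split=> [x Dx|]; last by apply: lin_least => // x [_ [l []]].
suff : lin [set x | x != 0 /\ exists l, eigenspaceI pi l x] `<=`
    [set y | D y /\ lin S' (A y)].
  rewrite -rep_span => /(_ (B x) (BD Dx))[_]; by rewrite BK.
apply: lin_least => [|y [y0 [l Iy]]].
  split=> [|k y z [Dy Ay] [Dz Az]].
    by split; [exact: subspace0|rewrite A0;
      exact: (subspace0 (lin_subspace _))].
  by split; [exact: Dlin|rewrite A_linear //; exact: (proj2 (lin_subspace _))].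
have [Dy _] := Iy; split=> //; apply: sub_lin; split.
  by apply: contra_neq y0 => Ay; rewrite -(AK Dy) Ay -A0 AK // ;
    exact: subspace0.
by exists l; exact: transported_eigenspace.
Qed.

(** The map A is linear on the domain only, hence the choice of generators
    inside the eigenspace. *)
Lemma transported_finite l : finite_dimensional (eigenspaceI transported l).
Proof.
have sD := dom_subspace pi.
have sE := eigenspaceI_subspace pi l.
have [s [sE' Es]] := finite_dimensional_generators sE (rep_finite pi_irr l).
exists (size s), (fun i => A s`_i) => x [Dx Ix].
have EBx : eigenspaceI pi l (B x).
  split; first exact: BD.
  have {}Ix : A (op pi (uq p gI) (B x)) = l *: x by [].
  rewrite -[LHS]AK; last exact: opD.
  by rewrite Ix -{1}(BK Dx) -tZ ?AK //; [apply: subspaceZ => //|]; exact: BD.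
rewrite -(BK Dx).
suff : lin [set` s] `<=`
    [set y | D y /\ lin (range (fun i : 'I_(size s) => A s`_i)) (A y)].
  by move=> /(_ _ (Es _ EBx))[].
apply: lin_least => [|y ys].
  split=> [|k y z [Dy Ay] [Dz Az]].
    by split; [exact: subspace0|rewrite A0;
      exact: (subspace0 (lin_subspace _))].
  by split; [exact: Dlin|rewrite A_linear //; exact: (proj2 (lin_subspace _))].
split; first by case: (sE' y ys).
have ys' := ys; rewrite /= -index_mem in ys'.
by apply: sub_lin; exists (Ordinal ys') => //=; rewrite nth_index.
Qed.

Definition transported_rep : representation p H :=
  Representation transported_span (fun _ => transported_finite).

Lemma transported_equivalent : equivalent pi transported_rep.
Proof.
exists D, D, A; split.
- split; last exact: dom_dense.
  by split=> //; [exact: dom_subspace|exact: op_dom].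
- split; last exact: dom_dense.
  split=> //; [exact: dom_subspace|exact: (op_dom (d := transported))].
- exact: A_linear.
- split=> [x Dx|x y /set_mem Dx /set_mem Dy e|x Dx].
  + exact: AD.
  + by rewrite -(AK Dx) e AK.
  + by exists (B x); [exact: BD|exact: BK].
- by move=> a x Dx; rewrite -transported_opA.
Qed.

End Transport.

(** * Realization in an orthonormal basis *)
Section Realization.
Variables (R : realType) (p : R[i]) (H : hilbertType R).
Variable pi : representation p H.
Hypothesis pi_irr : irreducible pi.

(** The base change from u to its Gram-Schmidt orthonormalization e preserves
    the domain, and the transported operators have in the basis e the matrices
    that the original ones have in the basis u. *)
Lemma realization (u : nat -> H) :
  (forall P, lcomb u P = 0 -> P = 0) -> dom pi = lin (range u) ->
  exists (e : nat -> H) (pi' : representation p H),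
    [/\ orthonormal_basis e, dom pi' = lin (range e), equivalent pi pi' &
      forall a n P, op pi a (u n) = lcomb u P -> op pi' a (e n) = lcomb e P].
Proof.
move=> free_u Du; pose e := gram_schmidt (dotp H) u.
have oe : forall i j, dotp H (e i) (e j) = (i == j)%:R.
  exact: gram_schmidt_orthonormal.
have De : dom pi = lin (range e) by rewrite gram_schmidt_lin.
have free_e := orthonormal_lcomb_eq0 oe.
pose A := base_change u e; pose B := base_change e u.
have AE P : A (lcomb u P) = lcomb e P by exact: base_change_lcomb.
have BE P : B (lcomb e P) = lcomb u P by exact: base_change_lcomb.
have uP x : dom pi x -> exists P, x = lcomb u P.
  by rewrite Du -lcomb_range => -[P _ <-]; exists P.
have eP x : dom pi x -> exists P, x = lcomb e P.
  by rewrite De -lcomb_range => -[P _ <-]; exists P.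
have Dlu P : dom pi (lcomb u P) by rewrite Du -lcomb_range; exists P.
have Dle P : dom pi (lcomb e P) by rewrite De -lcomb_range; exists P.
have AD x : dom pi x -> dom pi (A x) by move=> /uP[P ->]; rewrite AE.
have BD x : dom pi x -> dom pi (B x) by move=> /eP[P ->]; rewrite BE.
have A_linear (k : R[i]) x y : dom pi x -> dom pi y ->
  A (k *: x + y) = k *: A x + A y.
  by move=> /uP[P ->] /uP[Q ->]; rewrite -linearP !AE linearP.
have AK x : dom pi x -> B (A x) = x by move=> /uP[P ->]; rewrite AE BE.
have BK x : dom pi x -> A (B x) = x by move=> /eP[P ->]; rewrite BE AE.
exists e, (transported_rep pi_irr AD BD A_linear AK BK); split=> //.
- by split=> //; rewrite -De; exact: dom_dense.
- exact: transported_equivalent.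
move=> a n P uE; have Au : A (u n) = e n by rewrite -(lcombXn u) AE lcombXn.
have Dun : dom pi (u n) by rewrite -(lcombXn u n).
by rewrite -Au (transported_opA AD BD A_linear AK BK) // uE AE.
Qed.

End Realization.

(** * The domain of a representation as a module *)
Section DomainModule.
Variables (R : realType) (p : R[i]) (H : hilbertType R).
Variable pi : representation p H.

(** The operators of a representation are linear only on its domain.  Viewed as
    a module, the domain carries genuine linear endomorphisms, to which the
    algebraic classification applies. *)
Definition in_dom : {pred H} := fun x => `[< dom pi x >].

Lemma in_dom_closed : submod_closed in_dom.
Proof.
have sD := dom_subspace pi; split; first exact/asboolP/(subspace0 sD).
by move=> k x y /asboolP Dx /asboolP Dy; apply/asboolP; apply: (proj2 sD).
Qed.
HB.instance Definition _ :=
  GRing.isSubmodClosed.Build R[i] H in_dom in_dom_closed.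

Record domT := DomT { dom_val : H; _ : dom_val \in in_dom }.
HB.instance Definition _ := [isSub for dom_val].
HB.instance Definition _ := [Choice of domT by <:].
HB.instance Definition _ := [SubChoice_isSubLmodule of domT by <:].

Lemma dom_valP (x : domT) : dom pi (\val x).
Proof. exact/asboolP/(valP x). Qed.

Definition to_dom x (Dx : dom pi x) : domT := Sub x (asboolT Dx).

Lemma to_domK x (Dx : dom pi x) : \val (to_dom Dx) = x.
Proof. by rewrite SubK. Qed.

Definition dom_op a (x : domT) : domT := to_dom (op_dom a (dom_valP x)).

Lemma dom_opE a x : \val (dom_op a x) = op pi a (\val x).
Proof. exact: to_domK. Qed.

Lemma dom_op_linear a : linear (dom_op a).
Proof.
move=> k x y; apply: val_inj; rewrite linearP !dom_opE linearP.
exact: op_linear (dom_valP x) (dom_valP y).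
Qed.
HB.instance Definition _ a :=
  GRing.isLinear.Build R[i] domT domT _ (dom_op a) (dom_op_linear a).

Let subE a b x : dom_op (a - b) x = dom_op a x - dom_op b x.
Proof.
apply: val_inj; rewrite linearB !dom_opE -scaleN1r.
by rewrite op_add ?op_scale ?scaleN1r //; exact: dom_valP.
Qed.

Let scaleE k a x : dom_op (k *: a) x = k *: dom_op a x.
Proof. by apply: val_inj; rewrite linearZ !dom_opE /= op_scale //;
  exact: dom_valP. Qed.

Let mulE a b x : dom_op (a * b) x = dom_op a (dom_op b x).
Proof. by apply: val_inj; rewrite !dom_opE op_mul //; exact: dom_valP. Qed.

Let addE a b x : dom_op (a + b) x = dom_op a x + dom_op b x.
Proof. by apply: val_inj; rewrite linearD !dom_opE op_add //;
  exact: dom_valP. Qed.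

Let oneE x : dom_op 1 x = x.
Proof. by apply: val_inj; rewrite !dom_opE op_one //; exact: dom_valP. Qed.

Local Notation I := (dom_op (uq p gI)).
Local Notation T1 := (dom_op (uq p gT1)).
Local Notation T2 := (dom_op (uq p gT2)).

Lemma dom_op_relT1 v : p *: I (T2 v) - p^-1 *: T2 (I v) = T1 v.
Proof. by have [<- _ _] := uq_rels p; rewrite subE !scaleE !mulE. Qed.

Lemma dom_op_relT2 v : p *: T1 (I v) - p^-1 *: I (T1 v) = T2 v.
Proof. by have [_ <- _] := uq_rels p; rewrite subE !scaleE !mulE. Qed.

Lemma dom_op_relT12 v : p *: T2 (T1 v) - p^-1 *: T1 (T2 v) = 0.
Proof.
have [_ _ e] := uq_rels p; rewrite -!mulE -!scaleE -subE e.
by rewrite -(subrr 0) subE subrr.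
Qed.

Lemma eigenspaceI_domT l (x : domT) :
  eigenspaceI pi l (\val x) <-> I x = l *: x.
Proof.
split=> [[_ Ix]|Ix]; first by apply: val_inj; rewrite dom_opE Ix linearZ.
by split; [exact: dom_valP|rewrite -dom_opE Ix linearZ].
Qed.

Lemma lin_val (S : set domT) (S' : set H) :
  (forall y, S' y -> exists2 x, S x & \val x = y) ->
  forall x, lin S' (\val x) -> lin S x.
Proof.
move=> SS' x Lx; have sL := lin_subspace S.
suff [y Ly /val_inj <-] : exists2 y : domT, lin S y & \val y = \val x by [].
move: (\val x) Lx => {x}; apply: lin_least => [|y /SS'[x Sx <-]].
  split=> [|k _ _ [x Lx <-] [y Ly <-]].
    by exists 0; [exact: subspace0|exact: linear0].
  by exists (k *: x + y); [exact: (proj2 sL)|exact: linearP].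
by exists x => //; exact: sub_lin.
Qed.

Lemma dom_op_span v : lin [set w | exists l, I w = l *: w] v.
Proof.
have := dom_valP v; rewrite rep_span; apply: lin_val => y [_ [l Iy]].
have [Dy _] := Iy; exists (to_dom Dy); last exact: to_domK.
by exists l; apply/eigenspaceI_domT; rewrite to_domK.
Qed.

Hypothesis pi_irr : irreducible pi.

Lemma dom_op_finite l : finite_dimensional [set v | I v = l *: v].
Proof.
set E := [set v | _].
have sE := eigenspaceI_subspace pi l.
have [s [sE' Es]] := finite_dimensional_generators sE (rep_finite pi_irr l).
exists (size s), (fun i => insubd (0 : domT) s`_i) => x /eigenspaceI_domT/Es.
apply: lin_val => y ys; have [Dy _] := sE' y ys.
have ys' := ys; rewrite /= -index_mem in ys'.
exists (insubd 0 y); last by rewrite insubdK //; exact/asboolP.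
by exists (Ordinal ys') => //=; rewrite nth_index.
Qed.

Lemma dom_op_nonzero : exists v : domT, v != 0.
Proof.
have [nz _] := pi_irr; apply: contrapT => none; apply: nz.
apply/seteqP; split=> [x Dx|_ ->]; last exact: subspace0 (dom_subspace pi).
have /eqP x0 : to_dom Dx == 0 by apply/negPn/negP => x0; apply: none;
  exists (to_dom Dx).
by have := congr1 val x0; rewrite to_domK linear0.
Qed.

Lemma dom_op_simple (W : set domT) : linear_subspace W ->
  (forall v, W v -> W (I v)) -> (forall v, W v -> W (T2 v)) ->
  forall v, W v -> v != 0 -> forall w, W w.
Proof.
move=> sW WI WT2 v Wv v0 w.
have WT1 x : W x -> W (T1 x).
  by move=> Wx; rewrite -dom_op_relT1; apply: subspaceB => //;
    apply: subspaceZ => //; auto.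
have Wa a : forall x, W x -> W (dom_op a x).
  move: a; apply: uq_ind => [[]|k|a b Wa Wb|a b Wa Wb] x Wx; auto.
  - by rewrite scaleE oneE; exact: subspaceZ.
  - by rewrite addE; apply: subspaceD; auto.
  - by rewrite mulE; auto.
have [_ /(_ (dom_val @` W))[]] := pi_irr.
- split.
  + split=> [|k _ _ [x Wx <-] [y Wy <-]].
      by exists 0; [exact: subspace0|exact: (linear0 (\val : domT -> H))].
    by exists (k *: x + y); [exact: (proj2 sW)|exact:
      (linearP (\val : domT -> H))].
  + by move=> _ [x _ <-]; exact: dom_valP.
  + by move=> a _ [x Wx <-]; exists (dom_op a x); [exact: Wa|exact: dom_opE].
- move=> W0; have : [set 0] (\val v) by rewrite -W0; exists v.
  by move/eqP; rewrite -[0](linear0 (\val : domT -> H))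
    (inj_eq val_inj) (negPf v0).
- move=> WD; have : (dom_val @` W) (\val w) by rewrite WD; exact: dom_valP.
  by move=> [x Wx /val_inj <-].
Qed.

Lemma val_lcomb (v : nat -> domT) P : \val (lcomb v P) = lcomb (\val \o v) P.
Proof. by rewrite linear_sum; apply: eq_bigr => i _; rewrite linearZ. Qed.

Lemma dom_op_realization (J : eqType) (v : J -> domT)
    (f : nat -> J) (g : J -> nat) :
  cancel f g -> cancel g f ->
  (forall P, lcomb (v \o f) P = 0 -> P = 0) -> (forall w, lin (range v) w) ->
  exists (e : J -> H) (pi' : representation p H),
    [/\ orthonormal_basis e, dom pi' = lin (range e), equivalent pi pi',
      forall a j k, dom_op a (v j) = k *: v j -> op pi' a (e j) = k *: e j &
      forall a j k x y j1 j2, dom_op a (v j) = k *: (x *: v j1 + y *: v j2) ->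
        op pi' a (e j) = k *: (x *: e j1 + y *: e j2)].
Proof.
move=> fK gK free_v span_v; pose u := \val \o (v \o f).
have [||e [pi' [[oe de] De eq_pi opE]]] := @realization _ _ _ pi pi_irr u.
- move=> P; rewrite -val_lcomb => e0; apply: free_v; apply: val_inj.
  by rewrite e0 linear0.
- have sD := dom_subspace pi; apply/seteqP; split=> [x Dx|]; last first.
    by apply: lin_least => // _ [n _ <-]; exact: dom_valP.
  rewrite -lcomb_range -(to_domK Dx).
  have : range (lcomb (v \o f)) (to_dom Dx).
    rewrite lcomb_range.
    suff -> : range (v \o f) = range v by [].
    apply/seteqP; split=> _ [j _ <-]; first by exists (f j).
    by exists (g j) => //=; rewrite gK.
  by move=> [P _ <-]; exists P => //; rewrite val_lcomb.
have re : range (e \o g) = range e.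
  apply/seteqP; split=> _ [j _ <-]; first by exists (g j).
  by exists (f j) => //=; rewrite fK.
have uE j : \val (v j) = u (g j) by rewrite /u /= gK.
exists (e \o g), pi'; split=> //; rewrite ?re //.
- split=> [i j|]; last by rewrite re.
  by rewrite /= oe (inj_eq (can_inj gK)).
- move=> a j k /(congr1 val); rewrite dom_opE linearZ /= !uE => h.
  rewrite /= (opE a _ (k *: 'X^(g j))); first by rewrite linearZ /= lcombXn.
  by rewrite h linearZ /= lcombXn.
- move=> a j k x y j1 j2 /(congr1 val);
    rewrite dom_opE linearZ linearD !linearZ /= !uE => h.
  have lE b : lcomb b (k *: (x *: 'X^(g j1) + y *: 'X^(g j2)) : {poly R[i]}) =
      k *: (x *: b (g j1) + y *: b (g j2)) :> H.
    by rewrite linearZ linearD !linearZ /= !lcombXn.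
  by rewrite /= -lE; apply: opE; rewrite lE.
Qed.

End DomainModule.

(** * The classification theorem *)
Theorem theorem2 (R : realType) (q p : R[i])
    (q_neq0 : q != 0)
    (q_not_root_of_unity : forall n : nat, (0 < n)%N -> q ^+ n != 1)
    (p_sqrt : p ^+ 2 = q)
    (H : hilbertType R) (pi : representation p H)
    (pi_irr : irreducible pi) :
  [\/ exists r s : R[i],
        [/\ r != 0, s != 0,
            forall n : int, s != 'i * q ^ n /\ s != - ('i * q ^ n) &
            exists (H' : hilbertType R) (pi' : representation p H'),
              is_Rrs q r s pi' /\ equivalent pi pi'],
      exists r eps teps : R[i],
        [/\ r != 0, eps = 1 \/ eps = - 1, teps = 1 \/ teps = - 1 &
            exists (H' : hilbertType R) (pi' : representation p H'),
              is_Rr q r eps teps pi' /\ equivalent pi pi'] |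
      one_dimensional pi].
Proof.
case: _ / p_sqrt in q_neq0 q_not_root_of_unity *.
have p0 : p != 0 by move: q_neq0; rewrite expf_eq0.
have := classification p0 q_not_root_of_unity (@dom_op_relT1 _ _ _ pi)
  (@dom_op_relT2 _ _ _ pi) (@dom_op_relT12 _ _ _ pi) (@dom_op_span _ _ _ pi)
  (dom_op_simple pi_irr) (dom_op_finite pi_irr) (dom_op_nonzero pi_irr).
case=> [[r [s [v [r0 s0 s2 [free_v span_v vE]]]]]
  |[r [eps [v [r0 epsP [free_v span_v Iv T2v T1v]]]]]|[v v0 vE]].
- apply: Or31; exists r, s; split=> //.
    (* s = +- i q^n would give s^2 q^(-2 n) = -1. *)
    have s2E (n : int) : ('i * (p ^+ 2) ^ n) ^+ 2 * (p ^+ 2) ^ (- (n * 2)) =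
        -1 :> R[i].
      rewrite exprMn sqrCi mulN1r mulNr (exprnP (_ ^ n)) exprz_exp -expfzDr //.
      by rewrite subrr expr0z.
    move=> n; split; apply: contraNneq (s2 (- (n * 2))) => ->;
      rewrite ?sqrrN s2E //.
  have [e [pi' [oe De eq_pi eigE combE]]] :=
    dom_op_realization pi_irr int_of_natK nat_of_intK free_v span_v.
  exists H, pi'; split=> //; exists e; split=> // m; have [Im T2m T1m] := vE m;
    split.
  + exact: eigE.
  + rewrite -[e (m + 1)]scale1r -[e (m - 1)]scale1r; apply: combE.
    by rewrite !scale1r.
  + by rewrite -scaleNr; apply: combE; rewrite scaleNr.
- apply: Or32; exists r, eps, 1; split=> //; first by left.
  have idK : cancel (@id nat) id by [].
  have [e [pi' [oe De eq_pi eigE combE]]] :=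
    dom_op_realization pi_irr idK idK free_v span_v.
  exists H, pi'; split=> //; exists e; split=> //.
  + by move=> j; exact: (eigE _ _ _ (Iv j)).
  + split=> [|[//|j] _]; first by apply: combE; rewrite scale1r (proj1 T2v).
    rewrite -[e j.+2]scale1r -[e j.+1.-1]scale1r; apply: combE.
    by rewrite !scale1r (proj2 T2v).
  + split=> [|[//|j] _]; first by apply: combE; rewrite scale1r (proj1 T1v).
    by apply: combE; rewrite (proj2 T1v).
- apply: Or33; exists (\val v); split.
    by rewrite -[0](linear0 (\val : domT pi -> H)) (inj_eq val_inj).
  apply/seteqP; split=> [x Dx|].
    have [k kE] := vE (to_dom Dx); rewrite -(to_domK Dx) kE linearZ.
    by apply: subspaceZ; [exact: lin_subspace|exact: sub_lin].
  by apply: lin_least; [exact: dom_subspace|move=> _ ->; exact: dom_valP].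
Qed.
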